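(* Every path-connected pre-$\Delta$-monoid $M$ is transfinitely $\pi_1$-commutative at its identity element $e$. Consequently, for every map $f:(\mathbb{H},b_0)\to(M,e)$ there is a unique homomorphism $g:\mathbb{Z}^{\mathbb{N}}\cong\pi_1(\mathbb{T},x_0)\to\pi_1(M,e)$ with $g\circ\eta_\#=f_\#$.
   Context: A pre-$\Delta$-monoid is a space $M$ with an associative operation $\ast$ with identity $e$ such that for any continuous paths $\alpha,\beta:[0,1]\to M$, the pointwise product $t\mapsto\alpha(t)\ast\beta(t)$ is continuous. Let $\mathbb{H}=\bigcup_nC_n$ be the Hawaiian earring ($C_n\subset\mathbb{R}^2$ the circle of radius $1/n$ centered at $(1/n,0)$, basepoint $b_0=(0,0)$), $\ell_n$ the counterclockwise loop on $C_n$. A sequence of loops $\alpha_n\in\Omega(X,x)$ is a null-sequence if every neighborhood of $x$ contains all but finitely many $\mathrm{Im}(\alpha_n)$; then there is a unique map $f:(\mathbb{H},b_0)\to(X,x)$ with $f\circ\ell_n=\alpha_n$. With $\mathcal{C}\subseteq[0,1]$ the middle-thirds Cantor set and $[0,1]\setminus\mathcal{C}=\bigcup_{n\ge1}\bigcup_{k=1}^{2^{n-1}}I_n^k$ (open intervals of length $3^{-n}$, left to right for fixed $n$), $\ell_\tau$ is the loop with $\ell_\tau(\mathcal{C})=b_0$ equal to $\ell_{2^{n-1}+k-1}$ on $\overline{I_n^k}$, and $\prod_\tau\alpha_n:=f\circ\ell_\tau$. $X$ is transfinitely $\pi_1$-commutative at $x$ if $[\prod_\tau\alpha_n]=[\prod_\tau\alpha_{\phi(n)}]$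 for every null-sequence and every bijection $\phi:\mathbb{N}\to\mathbb{N}$. $\mathbb{T}=\prod_{n\in\mathbb{N}}S^1$ with basepoint $x_0$; $\eta:\mathbb{H}\to\mathbb{T}$ is the embedding onto $\bigvee_nS^1$ sending $C_n$ to the $n$-th circle factor, and $\pi_1(\mathbb{T},x_0)\cong\mathbb{Z}^\mathbb{N}$ with $[\eta\circ\ell_n]\mapsto\mathbf{e}_n$. *)

(* Defs.v *)
From Stdlib Require Import Reals Lra Lia Classical ClassicalEpsilon.
Open Scope R_scope.

Record Space := mkSpace { pt :> Type ; isOpen : (pt -> Prop) -> Prop }.
Arguments isOpen {_} _.

Definition is_topology (X : Space) : Prop :=
  isOpen (fun _ : X => True) /\
  (forall U V : X -> Prop, isOpen U -> isOpen V -> isOpen (fun x => U x /\ V x)) /\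
  (forall (J : Type) (F : J -> X -> Prop),
      (forall j, isOpen (F j)) -> isOpen (fun x => exists j, F j x)).

Definition continuous {X Y : Space} (f : X -> Y) : Prop :=
  forall U : Y -> Prop, isOpen U -> isOpen (fun x => U (f x)).

Definition Rtop : Space :=
  {| pt := R ;
     isOpen := fun U => forall x, U x ->
        exists eps, eps > 0 /\ forall y, Rabs (y - x) < eps -> U y |}.

Definition R2top : Space :=
  {| pt := (R * R)%type ;
     isOpen := fun U => forall x, U x ->
        exists eps, eps > 0 /\ forall y,
          sqrt ((fst y - fst x)^2 + (snd y - snd x)^2) < eps -> U y |}.

Definition Sub (X : Space) (P : X -> Prop) : Space :=
  {| pt := {x : X | P x} ;
     isOpen := fun V => forall x, V x ->
        exists U : X -> Prop, isOpen U /\ U (proj1_sig x) /\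
          forall y : {x : X | P x}, U (proj1_sig y) -> V y |}.

Definition Prod (X Y : Space) : Space :=
  {| pt := (X * Y)%type ;
     isOpen := fun V => forall p, V p ->
        exists (U1 : X -> Prop) (U2 : Y -> Prop),
          isOpen U1 /\ isOpen U2 /\ U1 (fst p) /\ U2 (snd p) /\
          forall q, U1 (fst q) -> U2 (snd q) -> V q |}.

Definition ProdN (X : Space) : Space :=
  {| pt := (nat -> X) ;
     isOpen := fun V => forall x, V x ->
        exists (N : nat) (U : nat -> X -> Prop),
          (forall i, (i < N)%nat -> isOpen (U i) /\ U i (x i)) /\
          forall y, (forall i, (i < N)%nat -> U i (y i)) -> V y |}.

Definition I : Space := Sub Rtop (fun t => 0 <= t <= 1).

Lemma clamp_in (r : R) : 0 <= Rmax 0 (Rmin 1 r) <= 1.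
Proof.
  unfold Rmax, Rmin; repeat destruct Rle_dec; lra.
Qed.

Definition clampI (r : R) : I := exist _ (Rmax 0 (Rmin 1 r)) (clamp_in r).

Definition i0 : I := clampI 0.
Definition i1 : I := clampI 1.

Definition is_loop {X : Space} (a : I -> X) (x : X) : Prop :=
  continuous a /\ a i0 = x /\ a i1 = x.

Definition path_homotopic {X : Space} (a b : I -> X) : Prop :=
  exists Hm : Prod I I -> X, continuous Hm /\
    (forall s, Hm (s, i0) = a s) /\ (forall s, Hm (s, i1) = b s) /\
    (forall t, Hm (i0, t) = a i0) /\ (forall t, Hm (i1, t) = a i1).

Definition concat {X : Space} (a b : I -> X) : I -> X :=
  fun t => if Rle_dec (proj1_sig t) (1/2)
           then a (clampI (2 * proj1_sig t))
           else b (clampI (2 * proj1_sig t - 1)).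

Definition null_sequence {X : Space} (x : X) (alpha : nat -> I -> X) : Prop :=
  (forall n, is_loop (alpha n) x) /\
  forall U : X -> Prop, isOpen U -> U x ->
    exists N, forall n, (N <= n)%nat -> forall t, U (alpha n t).

(* Cantor-set gaps.  Level j (= n-1 in the paper), position p (= k-1),
   0 <= p < 2^j.  The gap I_(j+1)^(p+1) is the open interval
   (gap_left j p, gap_left j p + 3^-(j+1)), where
   gap_left j p = sum_{i=1}^{j} 2 b_i 3^-i + 3^-(j+1) with b_1...b_j the binary
   digits of p (most significant first); gaps are thus listed left to right. *)
Fixpoint gap_off (j p : nat) : R :=
  match j with
  | O => 0
  | S j' => (if Nat.odd p then 2 / 3 ^ (S j') else 0) + gap_off j' (Nat.div2 p)
  end.

Definition gap_left (j p : nat) : R := gap_off j p + / 3 ^ (S j).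

Definition in_gap (j p : nat) (t : R) : Prop :=
  (p < 2 ^ j)%nat /\ gap_left j p < t < gap_left j p + / 3 ^ (S j).

(* 0-based index of the loop on gap (j,p): paper's 2^(n-1)+k-1, shifted by -1. *)
Definition gap_index (j p : nat) : nat := (2 ^ j + p - 1)%nat.

Definition tprod {X : Space} (x : X) (alpha : nat -> I -> X) : I -> X :=
  fun t => epsilon (inhabits x) (fun v =>
    (exists j p, in_gap j p (proj1_sig t) /\
       v = alpha (gap_index j p)
             (clampI ((proj1_sig t - gap_left j p) * 3 ^ (S j)))) \/
    ((forall j p, ~ in_gap j p (proj1_sig t)) /\ v = x)).

Definition bijective_nat (phi : nat -> nat) : Prop :=
  (forall m n, phi m = phi n -> m = n) /\ (forall m, exists n, phi n = m).

Definition transfinitely_pi1_commutative {X : Space} (x : X) : Prop :=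
  forall alpha : nat -> I -> X, null_sequence x alpha ->
  forall phi : nat -> nat, bijective_nat phi ->
    path_homotopic (tprod x alpha) (tprod x (fun n => alpha (phi n))).

Definition pre_delta_monoid (M : Space) (op : M -> M -> M) (e : M) : Prop :=
  (forall a b c, op a (op b c) = op (op a b) c) /\
  (forall a, op e a = a /\ op a e = a) /\
  (forall al be : I -> M, continuous al -> continuous be ->
     continuous (fun t => op (al t) (be t))).

Definition path_connected (X : Space) : Prop :=
  forall a b : X, exists p : I -> X, continuous p /\ p i0 = a /\ p i1 = b.

(* C_(n+1) : circle of radius 1/(n+1) centred at (1/(n+1), 0) (0-based n). *)
Definition onC (n : nat) (p : R * R) : Prop :=
  (fst p - / INR (S n)) ^ 2 + (snd p) ^ 2 = (/ INR (S n)) ^ 2.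

Definition HE : Space := Sub R2top (fun p => exists n, onC n p).

Lemma b0_in : exists n, onC n (0, 0).
Proof. exists O; unfold onC; simpl; lra. Qed.

Definition b0 : HE := exist _ (0, 0) b0_in.

Definition S1 : Space := Sub R2top (fun p => (fst p) ^ 2 + (snd p) ^ 2 = 1).

Lemma s1base_in : (fst (1, 0)) ^ 2 + (snd (1, 0)) ^ 2 = 1.
Proof. simpl; lra. Qed.

Definition s1base : S1 := exist _ (1, 0) s1base_in.

Definition T : Space := ProdN S1.
Definition x0 : T := fun _ => s1base.

Lemma eta_coord_in (n : nat) (p : R * R) : onC n p ->
  (fst (1 - INR (S n) * fst p, - (INR (S n) * snd p))) ^ 2 +
  (snd (1 - INR (S n) * fst p, - (INR (S n) * snd p))) ^ 2 = 1.
Proof.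
  unfold onC; intro h; cbn [fst snd].
  assert (hc : INR (S n) > 0) by (apply lt_0_INR; lia).
  set (c := INR (S n)) in *.
  set (u := fst p) in *; set (v := snd p) in *.
  assert (E : (u - / c) ^ 2 + v ^ 2 - (/ c) ^ 2 = u * u + v * v - 2 * u * / c) by ring.
  assert (h2 : u * u + v * v = 2 * u * / c) by lra.
  assert (h3 : c * c * (u * u + v * v) = 2 * c * u).
  { rewrite h2; field; lra. }
  assert (E2 : (1 - c * u) ^ 2 + (- (c * v)) ^ 2 = 1 - 2 * c * u + c * c * (u * u + v * v)) by ring.
  lra.
Qed.

(* eta maps C_(n+1) onto the (n+1)-st circle factor (0-based coordinate n),
   by the orientation-preserving similarity p |-> (1 - c p_1, - c p_2),
   c = n+1, which sends b0 to the base point (1,0). *)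
Definition eta (q : HE) : T := fun n =>
  match excluded_middle_informative (onC n (proj1_sig q)) with
  | left h => exist _ _ (eta_coord_in n (proj1_sig q) h)
  | right _ => s1base
  end.

(** * Induced homomorphisms on pi_1, encoded on representative loops *)
Definition induces_pi1_hom {X Y : Space} (x : X) (y : Y)
    (g : (I -> X) -> (I -> Y)) : Prop :=
  (forall a, is_loop a x -> is_loop (g a) y) /\
  (forall a b, is_loop a x -> is_loop b x -> path_homotopic a b ->
     path_homotopic (g a) (g b)) /\
  (forall a b, is_loop a x -> is_loop b x ->
     path_homotopic (g (concat a b)) (concat (g a) (g b))).

(* Main.v *)
(* For disjointly supported loops [a n], the pointwise "sum" of all of them equals
   [a 0 * (sum of the rest)], since [e] is the identity. An Eilenberg swindle on the
   tails shows that the sum of a null sequence is homotopic to the plain infinite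
   concatenation [winf a]; in particular the order in which the loops are traversed
   is irrelevant. For a loop [a] in the torus, [g a] is the infinite concatenation of
   the loops [f o circle n o a_n], where [a_n] is the [n]-th coordinate and [circle n]
   the inclusion of the [n]-th circle; no winding numbers are needed. On the image of
   a loop [c] of [HE] this is the reordering of [f o c], and every loop in the torus
   is homotopic to such an image, whence uniqueness. *)

From Stdlib Require Import Reals Lra Lia Classical ClassicalEpsilon
  FunctionalExtensionality PropExtensionality.
Require Import Defs.
From Stdlib Require Import Reals.

(** The main obstacle is that the product of a pre-Delta-monoid is continuous only along paths,
    while multiplying two homotopies needs continuity on the square. [continuous_pathwise] removes
    it: continuity on [Prod I I] can be tested on paths. The swindle is conclusive because loops
    have inverses up to homotopy, so the concatenated tails can be cancelled ([ph_op_cancel]). Sums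
    and concatenations are both instances of [dsum], which at each time picks the only value that
    may differ from the base point. Splitting off a term and interchanging products with
    concatenations then become equalities of functions, and homotopies are left only for changes of
    clock. *)

(** * Local criteria for openness and continuity *)

Lemma open_local {X : Space} (P : X -> Prop) : is_topology X ->
  (forall x, P x -> exists V, isOpen V /\ V x /\ forall y, V y -> P y) -> isOpen P.
Proof.
  intros (_ & _ & HU) H.
  (* The union axiom takes a family over any type; here the index type is that of all open subsets
     of [P]. *)
  set (F := fun (j : {V : X -> Prop | isOpen V /\ forall y, V y -> P y}) => proj1_sig j).
  replace P with (fun x => exists j, F j x).
  - apply HU; intros [V [oV hV]]; exact oV.
  - apply functional_extensionality; intro x; apply propositional_extensionality; split.
    + intros [[V [oV hV]] Vx]; exact (hV x Vx).
    + intro Px; destruct (H x Px) as (V & oV & Vx & hV).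
      exists (exist _ V (conj oV hV)); exact Vx.
Qed.

Lemma continuous_local {X Y : Space} (f : X -> Y) : is_topology X ->
  (forall x U, isOpen U -> U (f x) ->
     exists V, isOpen V /\ V x /\ forall y, V y -> U (f y)) -> continuous f.
Proof. intros tX H U oU; apply open_local; auto. Qed.

Lemma continuous_comp {X Y Z : Space} (g : Y -> Z) (f : X -> Y) :
  continuous g -> continuous f -> continuous (fun x => g (f x)).
Proof. intros cg cf U oU; exact (cf _ (cg U oU)). Qed.

Lemma continuous_const {X Y : Space} (c : Y) : is_topology X ->
  continuous (fun _ : X => c).
Proof.
  intro tX; apply continuous_local; auto; intros x U _ Uc.
  exists (fun _ => True); destruct tX; auto.
Qed.

Lemma continuous_id {X : Space} : continuous (fun x : X => x).
Proof. intros U oU; exact oU. Qed.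

Lemma open_bounded_forall {X : Space} (x : X) (P : nat -> X -> Prop) (N : nat) :
  is_topology X ->
  (forall i, (i < N)%nat -> exists V, isOpen V /\ V x /\ forall y, V y -> P i y) ->
  exists V, isOpen V /\ V x /\ forall y, V y -> forall i, (i < N)%nat -> P i y.
Proof.
  intros tX; induction N as [|N IH]; intro H.
  - exists (fun _ => True); destruct tX as [oT _]; repeat split; auto; intros; lia.
  - destruct IH as (V & oV & Vx & hV); [intros; apply H; lia|].
    destruct (H N) as (W & oW & Wx & hW); [lia|].
    destruct tX as (_ & oI & _).
    exists (fun y => V y /\ W y); repeat split; auto.
    intros y [Vy Wy] i hi.
    destruct (Nat.eq_dec i N) as [->|ne]; auto; apply hV; auto; lia.
Qed.

(** Pasting lemma. On the seam [c x = r] both preimages of [U] are neighbourhoods of [x], and their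
    intersection serves whichever branch is taken. *)
Lemma continuous_if {X Y : Space} (f g : X -> Y) (c : X -> Rtop) (r : R) :
  is_topology X -> continuous f -> continuous g -> continuous c ->
  (forall x, c x = r -> f x = g x) ->
  continuous (fun x => if Rle_dec (c x) r then f x else g x).
Proof.
  intros tX cf cg cc E; apply continuous_local; auto; intros x U oU Ux.
  assert (oI := proj1 (proj2 tX)).
  assert (oL : isOpen (fun y => c y < r)).
  { apply (cc (fun z => z < r)); intros z hz.
    exists (r - z); split; [lra|]; intros y hy; apply Rabs_def2 in hy; lra. }
  assert (oG : isOpen (fun y => r < c y)).
  { apply (cc (fun z => r < z)); intros z hz.
    exists (z - r); split; [lra|]; intros y hy; apply Rabs_def2 in hy; lra. }
  destruct (Rtotal_order (c x) r) as [h|[h|h]].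
  - exists (fun y => c y < r /\ U (f y)); repeat split; auto.
    + destruct (Rle_dec (c x) r); auto; lra.
    + intros y [h1 h2]; destruct (Rle_dec (c y) r); auto; lra.
  - exists (fun y => U (f y) /\ U (g y)); repeat split; auto.
    + destruct (Rle_dec (c x) r); auto; lra.
    + destruct (Rle_dec (c x) r); [|lra]; rewrite <- E; auto.
    + intros y [h1 h2]; destruct (Rle_dec (c y) r); auto.
  - exists (fun y => r < c y /\ U (g y)); repeat split; auto.
    + destruct (Rle_dec (c x) r); auto; lra.
    + intros y [h1 h2]; destruct (Rle_dec (c y) r); auto; lra.
Qed.

(** * Topologies of the concrete spaces and continuity of real-valued functions *)

Lemma Rtop_topology : is_topology Rtop.
Proof.
  split; [|split].
  - intros x _; exists 1; split; [lra|auto].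
  - intros U V oU oV x [Ux Vx].
    destruct (oU x Ux) as (d1 & p1 & h1), (oV x Vx) as (d2 & p2 & h2).
    exists (Rmin d1 d2); split; [apply Rmin_pos; auto|].
    intros y hy; split; [apply h1|apply h2].
    + exact (Rlt_le_trans _ _ _ hy (Rmin_l _ _)).
    + exact (Rlt_le_trans _ _ _ hy (Rmin_r _ _)).
  - intros J F oF x [j Fx]; destruct (oF j x Fx) as (d & p & h).
    exists d; split; auto; intros y hy; exists j; auto.
Qed.

Lemma R2top_topology : is_topology R2top.
Proof.
  split; [|split].
  - intros x _; exists 1; split; [lra|auto].
  - intros U V oU oV x [Ux Vx].
    destruct (oU x Ux) as (d1 & p1 & h1), (oV x Vx) as (d2 & p2 & h2).
    exists (Rmin d1 d2); split; [apply Rmin_pos; auto|].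
    intros y hy; split; [apply h1|apply h2].
    + exact (Rlt_le_trans _ _ _ hy (Rmin_l _ _)).
    + exact (Rlt_le_trans _ _ _ hy (Rmin_r _ _)).
  - intros J F oF x [j Fx]; destruct (oF j x Fx) as (d & p & h).
    exists d; split; auto; intros y hy; exists j; auto.
Qed.

Lemma Sub_topology (X : Space) (P : X -> Prop) : is_topology X -> is_topology (Sub X P).
Proof.
  intros (oT & oI & oU); split; [|split].
  - intros x _; exists (fun _ => True); auto.
  - intros U V hU hV x [Ux Vx].
    destruct (hU x Ux) as (A & oA & Ax & hA), (hV x Vx) as (B & oB & Bx & hB).
    exists (fun y => A y /\ B y); repeat split; auto; intros; destruct H; auto.
  - intros J F hF x [j Fx]; destruct (hF j x Fx) as (A & oA & Ax & hA).
    exists A; repeat split; auto; intros; exists j; auto.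
Qed.

Lemma Prod_topology (X Y : Space) : is_topology X -> is_topology Y ->
  is_topology (Prod X Y).
Proof.
  intros (oT & oI & oU) (oT' & oI' & oU'); split; [|split].
  - intros x _; exists (fun _ => True), (fun _ => True); auto 6.
  - intros U V hU hV x [Ux Vx].
    destruct (hU x Ux) as (A & A' & oA & oA' & Ax & Ax' & hA).
    destruct (hV x Vx) as (B & B' & oB & oB' & Bx & Bx' & hB).
    exists (fun y => A y /\ B y), (fun y => A' y /\ B' y); repeat split; auto.
    + apply hA; tauto.
    + apply hB; tauto.
  - intros J F hF x [j Fx]; destruct (hF j x Fx) as (A & A' & oA & oA' & Ax & Ax' & hA).
    exists A, A'; repeat split; auto; intros; exists j; auto.
Qed.

Lemma I_topology : is_topology I.
Proof. apply Sub_topology, Rtop_topology. Qed.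

Lemma II_topology : is_topology (Prod I I).
Proof. apply Prod_topology; apply I_topology. Qed.

#[local] Hint Resolve Rtop_topology R2top_topology I_topology II_topology : topo.

Lemma continuous_proj1 {X : Space} (P : X -> Prop) :
  continuous (fun x : Sub X P => (proj1_sig x : X)).
Proof. intros U oU x Ux; exists U; auto. Qed.

Lemma continuous_to_sub {X Y : Space} {P : Y -> Prop} (f : X -> Sub Y P) :
  is_topology X -> continuous (fun x => proj1_sig (f x) : Y) -> continuous f.
Proof.
  intros tX cf; apply continuous_local; auto; intros x U oU Ux.
  destruct (oU _ Ux) as (A & oA & Ax & hA).
  exists (fun y => A (proj1_sig (f y))); split; [exact (cf A oA)|auto].
Qed.

Lemma continuous_fst {X Y : Space} : is_topology Y ->
  continuous (fun p : Prod X Y => (fst p : X)).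
Proof.
  intros [oT _] U oU p Up; exists U, (fun _ => True); auto 6.
Qed.

Lemma continuous_snd {X Y : Space} : is_topology X ->
  continuous (fun p : Prod X Y => (snd p : Y)).
Proof.
  intros [oT _] U oU p Up; exists (fun _ => True), U; auto 6.
Qed.

Lemma continuous_pair {Z X Y : Space} (f : Z -> X) (g : Z -> Y) : is_topology Z ->
  continuous f -> continuous g -> continuous (fun z => ((f z, g z) : Prod X Y)).
Proof.
  intros tZ cf cg; apply continuous_local; auto; intros x U oU Ux.
  destruct (oU _ Ux) as (A & B & oA & oB & Ax & Bx & h).
  exists (fun z => A (f z) /\ B (g z)); repeat split; auto.
  - apply (proj1 (proj2 tZ)); auto.
  - intros y [h1 h2]; apply h; auto.
Qed.

Lemma continuous_coord (X : Space) (n : nat) : is_topology X ->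
  continuous (fun x : ProdN X => x n).
Proof.
  intros [oT _] U oU x Ux.
  exists (S n), (fun i => match Nat.eq_dec i n with left _ => U | right _ => fun _ => True end).
  split.
  - intros i _; destruct (Nat.eq_dec i n) as [->|]; auto.
  - intros y hy; specialize (hy n ltac:(lia)); destruct (Nat.eq_dec n n); tauto.
Qed.

Lemma continuous_to_ProdN {X Y : Space} (f : X -> ProdN Y) : is_topology X ->
  (forall n, continuous (fun x => f x n)) -> continuous f.
Proof.
  intros tX cf; apply continuous_local; auto; intros x V oV Vx.
  destruct (oV _ Vx) as (N & U & hU & h).
  destruct (open_bounded_forall x (fun i y => U i (f y i)) N tX) as (W & oW & Wx & hW).
  - intros i hi; destruct (hU i hi) as [oUi Ui].
    exists (fun y => U i (f y i)); split; [exact (cf i _ oUi)|auto].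
  - exists W; auto.
Qed.

Lemma continuous_to_R {X : Space} (f : X -> Rtop) : is_topology X ->
  (forall x eps, eps > 0 -> exists V, isOpen V /\ V x /\
     forall y, V y -> Rabs (f y - f x) < eps) -> continuous f.
Proof.
  intros tX H; apply continuous_local; auto; intros x U oU Ux.
  destruct (oU _ Ux) as (eps & he & hU).
  destruct (H x eps he) as (V & oV & Vx & hV); exists V; auto.
Qed.

Lemma open_ball_R {X : Space} (f : X -> Rtop) (x : X) (eps : R) :
  continuous f -> isOpen (fun y => Rabs (f y - f x) < eps).
Proof.
  intros cf; apply (cf (fun z => Rabs (z - f x) < eps)); intros z hz.
  exists (eps - Rabs (z - f x)); split; [lra|]; intros y hy.
  replace (y - f x) with ((y - z) + (z - f x)) by ring.
  eapply Rle_lt_trans; [apply Rabs_triang|lra].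
Qed.

Lemma continuous_real2 {X : Space} (F : R -> R -> R) (f g : X -> Rtop) :
  is_topology X ->
  (forall a b eps, eps > 0 -> exists d, d > 0 /\ forall a' b',
     Rabs (a' - a) < d -> Rabs (b' - b) < d -> Rabs (F a' b' - F a b) < eps) ->
  continuous f -> continuous g -> continuous (fun x => F (f x) (g x) : Rtop).
Proof.
  intros tX HF cf cg; apply continuous_to_R; auto; intros x eps he.
  destruct (HF (f x) (g x) eps he) as (d & hd & h).
  exists (fun y => Rabs (f y - f x) < d /\ Rabs (g y - g x) < d); repeat split.
  - apply (proj1 (proj2 tX)); apply open_ball_R; auto.
  - replace (f x - f x) with 0 by ring; rewrite Rabs_R0; auto.
  - replace (g x - g x) with 0 by ring; rewrite Rabs_R0; auto.
  - intros y []; auto.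
Qed.

Lemma continuous_plus {X : Space} (f g : X -> Rtop) : is_topology X ->
  continuous f -> continuous g -> continuous (fun x => f x + g x : Rtop).
Proof.
  intros tX cf cg; apply (continuous_real2 Rplus); auto; intros a b eps he.
  exists (eps / 2); split; [lra|]; intros a' b' ha hb.
  replace (a' + b' - (a + b)) with ((a' - a) + (b' - b)) by ring.
  eapply Rle_lt_trans; [apply Rabs_triang|lra].
Qed.

Lemma continuous_mult {X : Space} (f g : X -> Rtop) : is_topology X ->
  continuous f -> continuous g -> continuous (fun x => f x * g x : Rtop).
Proof.
  intros tX cf cg; apply (continuous_real2 Rmult); auto; intros a b eps he.
  (* The difference of products splits into three terms. With both increments below [eps / K], and
     the first below 1, they are bounded by [eps / K] times 1, [Rabs b] and [Rabs a], which add up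
     to [eps]. *)
  set (K := Rabs a + Rabs b + 1).
  assert (hK : K > 0) by (unfold K; pose proof (Rabs_pos a); pose proof (Rabs_pos b); lra).
  assert (hq : eps / K > 0) by (apply Rdiv_lt_0_compat; auto).
  exists (Rmin 1 (eps / K)); split; [apply Rmin_pos; lra|]; intros a' b' ha hb.
  assert (ha1 := Rlt_le_trans _ _ _ ha (Rmin_r _ _)).
  assert (hb1 := Rlt_le_trans _ _ _ hb (Rmin_r _ _)).
  assert (ha2 := Rlt_le_trans _ _ _ ha (Rmin_l _ _)).
  replace (a' * b' - a * b) with ((a' - a) * (b' - b) + (a' - a) * b + a * (b' - b)) by ring.
  eapply Rle_lt_trans; [apply Rabs_triang|].
  eapply Rle_lt_trans; [apply Rplus_le_compat_r, Rabs_triang|].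
  rewrite !Rabs_mult.
  pose proof (Rabs_pos a); pose proof (Rabs_pos b).
  pose proof (Rabs_pos (a' - a)); pose proof (Rabs_pos (b' - b)).
  replace eps with (eps / K * 1 + eps / K * Rabs b + Rabs a * (eps / K)) by (unfold K in *; field; lra).
  nra.
Qed.

Lemma continuous_minus {X : Space} (f g : X -> Rtop) : is_topology X ->
  continuous f -> continuous g -> continuous (fun x => f x - g x : Rtop).
Proof.
  intros tX cf cg.
  replace (fun x => f x - g x) with (fun x => f x + (-1) * g x)
    by (apply functional_extensionality; intro; ring).
  apply continuous_plus; auto; apply continuous_mult; auto; apply continuous_const; auto.
Qed.

(** * The unit interval and clamping *)

Lemma sig_eq {A : Type} (P : A -> Prop) (u v : {x | P x}) :
  proj1_sig u = proj1_sig v -> u = v.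
Proof.
  destruct u as [x hx], v as [y hy]; simpl; intros <-; f_equal; apply proof_irrelevance.
Qed.

Lemma clampI_val (r : R) : proj1_sig (clampI r) = Rmax 0 (Rmin 1 r).
Proof. reflexivity. Qed.

Ltac clamp := unfold clampI, i0, i1 in *; simpl proj1_sig in *;
  unfold Rmax, Rmin in *; repeat destruct Rle_dec; try lra.

Lemma clampI_id (t : I) : clampI (proj1_sig t) = t.
Proof. apply sig_eq; destruct t as [t ht]; clamp. Qed.

Lemma clampI_in (r : R) : 0 <= r <= 1 -> proj1_sig (clampI r) = r.
Proof. intro; clamp. Qed.

Lemma clampI_le0 (r : R) : r <= 0 -> clampI r = i0.
Proof. intro; apply sig_eq; clamp. Qed.

Lemma clampI_ge1 (r : R) : 1 <= r -> clampI r = i1.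
Proof. intro; apply sig_eq; clamp. Qed.

Lemma i0_val : proj1_sig i0 = 0.
Proof. clamp. Qed.

Lemma i1_val : proj1_sig i1 = 1.
Proof. clamp. Qed.

Lemma continuous_clampI : continuous (clampI : Rtop -> I).
Proof.
  apply continuous_to_sub; auto with topo.
  apply continuous_to_R; auto with topo; intros x eps he.
  exists (fun y => Rabs (y - x) < eps); repeat split.
  - apply (open_ball_R (fun y : Rtop => y)); apply continuous_id.
  - replace (x - x) with 0 by ring; rewrite Rabs_R0; auto.
  - intros y hy; eapply Rle_lt_trans; [|exact hy]; clear.
    cbn; unfold Rmax, Rmin; repeat destruct Rle_dec; unfold Rabs;
    repeat destruct Rcase_abs; lra.
Qed.

Lemma continuous_clampI_comp {X : Space} (f : X -> Rtop) :
  continuous f -> continuous (fun x => clampI (f x)).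
Proof. apply (continuous_comp (clampI : Rtop -> I)), continuous_clampI. Qed.

Lemma continuous_val : continuous (fun t : I => proj1_sig t : Rtop).
Proof. apply continuous_proj1. Qed.

Lemma continuous_val_comp {X : Space} (f : X -> I) :
  continuous f -> continuous (fun x => proj1_sig (f x) : Rtop).
Proof. apply (continuous_comp (fun t : I => proj1_sig t : Rtop)), continuous_val. Qed.

Lemma continuous_fst_I : continuous (fun p : Prod I I => (fst p : I)).
Proof. apply continuous_fst; auto with topo. Qed.

Lemma continuous_snd_I : continuous (fun p : Prod I I => (snd p : I)).
Proof. apply continuous_snd; auto with topo. Qed.

Ltac cont := repeat first
  [ assumption | solve [auto with topo]
  | apply continuous_clampI_comp | apply continuous_fst_I | apply continuous_snd_I
  | apply continuous_val | apply continuous_id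
  | apply continuous_minus | apply continuous_plus | apply continuous_mult
  | apply continuous_const | apply continuous_val_comp ].

(** * Disjointly supported families *)

Definition vanishing {X Y : Space} (x : Y) (a : nat -> X -> Y) : Prop :=
  forall U : Y -> Prop, isOpen U -> U x ->
    exists N, forall n, (N <= n)%nat -> forall t, U (a n t).

Definition disjoint_supp {X Y : Space} (x : Y) (a : nat -> X -> Y) : Prop :=
  forall t, exists n, forall m, m <> n -> a m t = x.

(* For a family of disjoint supports, the pointwise "sum" [x * x * a_n t * x * ...]. *)
Definition dsum {X Y : Space} (x : Y) (a : nat -> X -> Y) (t : X) : Y :=
  epsilon (inhabits x) (fun v =>
    (exists n, a n t <> x /\ v = a n t) \/ ((forall n, a n t = x) /\ v = x)).

Lemma dsum_at {X Y : Space} (x : Y) (a : nat -> X -> Y) (t : X) (n : nat) :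
  (forall m, m <> n -> a m t = x) -> dsum x a t = a n t.
Proof.
  intro H; unfold dsum; set (P := fun v => _ \/ _).
  assert (E : P (epsilon (inhabits x) P)).
  { apply epsilon_spec; unfold P.
    destruct (classic (a n t = x)) as [h|h].
    - exists x; right; split; auto; intro m; destruct (Nat.eq_dec m n) as [->|]; auto.
    - exists (a n t); left; exists n; auto. }
  destruct E as [(m & h & ->)|[h ->]]; auto.
  destruct (Nat.eq_dec m n) as [->|hm]; auto; elim h; auto.
Qed.

Lemma dsum_const {X Y : Space} (x : Y) (a : nat -> X -> Y) (t : X) :
  (forall m, a m t = x) -> dsum x a t = x.
Proof. intro H; rewrite (dsum_at x a t 0); auto. Qed.

(** Two points are allowed because [winf_shift] compares a sum at [t] with a sum at the doubled
    time; the value depends only on the sequence of summands. *)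
Lemma dsum_ext {X X' Y : Space} (x : Y) (a : nat -> X -> Y) (b : nat -> X' -> Y) (t : X) (t' : X') :
  (forall n, a n t = b n t') -> dsum x a t = dsum x b t'.
Proof.
  intro E; unfold dsum;
  set (D := fun s : nat -> Y => epsilon (inhabits x) (fun v =>
    (exists n, s n <> x /\ v = s n) \/ ((forall n, s n = x) /\ v = x))).
  change (D (fun n => a n t) = D (fun n => b n t')).
  f_equal; apply functional_extensionality; auto.
Qed.

(* [Y] need not be Hausdorff, so the support of [a n] need not be open; one
   distinguishes whether the target neighbourhood contains the base point. *)
Lemma dsum_continuous {X Y : Space} (x : Y) (a : nat -> X -> Y) :
  is_topology X -> (forall n, continuous (a n)) -> vanishing x a ->
  disjoint_supp x a -> continuous (dsum x a).
Proof.
  intros tX ca va da; apply continuous_local; auto; intros t U oU Ut.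
  destruct (da t) as [n hn]; rewrite (dsum_at x a t n hn) in Ut.
  destruct (classic (U x)) as [Ux|nUx].
  - destruct (va U oU Ux) as [N hN].
    destruct (open_bounded_forall t (fun i y => U (a i y)) N tX) as (V & oV & Vt & hV).
    + intros i _; exists (fun y => U (a i y)); repeat split; auto.
      * exact (ca i U oU).
      * destruct (Nat.eq_dec i n) as [->|ne]; auto; rewrite hn; auto.
    + exists V; repeat split; auto; intros y Vy.
      destruct (da y) as [k hk]; rewrite (dsum_at x a y k hk).
      destruct (Nat.le_gt_cases N k); auto.
  - exists (fun y => U (a n y)); repeat split; auto; [exact (ca n U oU)|].
    intros y Uy; destruct (da y) as [k hk]; rewrite (dsum_at x a y k hk).
    destruct (Nat.eq_dec n k) as [->|ne]; auto.
    rewrite (hk n ne) in Uy; tauto.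
Qed.

Lemma disjoint_supp_shift {X Y : Space} (x : Y) (a : nat -> X -> Y) (n : nat) :
  disjoint_supp x a -> disjoint_supp x (fun k => a (n + k)%nat).
Proof.
  intros da t; destruct (da t) as [k hk]; exists (k - n)%nat; intros m hm; apply hk; lia.
Qed.

(** At each point a tail takes the value of a single [a (n + k)], so the tails are as small as the
    terms. This makes the tails a null sequence in the swindle. *)
Lemma vanishing_tails {X Y : Space} (x : Y) (a : nat -> X -> Y) :
  vanishing x a -> disjoint_supp x a -> vanishing x (fun n => dsum x (fun k => a (n + k)%nat)).
Proof.
  intros va da U oU Ux; destruct (va U oU Ux) as [N hN]; exists N; intros n hn t.
  destruct (disjoint_supp_shift x a n da t) as [k hk].
  rewrite (dsum_at x _ t k hk); apply hN; lia.
Qed.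

(** * Path homotopies *)

Lemma ph_refl {X : Space} (a : I -> X) : continuous a -> path_homotopic a a.
Proof.
  intro ca; exists (fun p : Prod I I => a (fst p)); repeat split; auto.
  apply (continuous_comp a); cont.
Qed.

Lemma ph_sym {X : Space} (a b : I -> X) :
  a i0 = b i0 -> a i1 = b i1 -> path_homotopic a b -> path_homotopic b a.
Proof.
  intros E0 E1 (H & cH & H0 & H1 & Hl & Hr).
  exists (fun p : Prod I I => H (fst p, clampI (1 - proj1_sig (snd p))));
    split; [|split; [|split; [|split]]]; cbn [fst snd].
  - apply (continuous_comp H); auto; refine (continuous_pair (X := I) (Y := I) _ _ _ _ _); cont.
  - intro s; rewrite i0_val, (clampI_ge1 (1 - 0)) by lra; auto.
  - intro s; rewrite i1_val, (clampI_le0 (1 - 1)) by lra; auto.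
  - intro t; rewrite Hl; auto.
  - intro t; rewrite Hr; auto.
Qed.

Lemma ph_sym_loop {X : Space} (x : X) (a b : I -> X) :
  is_loop a x -> is_loop b x -> path_homotopic a b -> path_homotopic b a.
Proof. intros (_ & a0 & a1) (_ & b0 & b1); apply ph_sym; congruence. Qed.

Lemma ph_trans {X : Space} (a b c : I -> X) :
  path_homotopic a b -> path_homotopic b c -> path_homotopic a c.
Proof.
  intros (H & cH & H0 & H1 & Hl & Hr) (K & cK & K0 & K1 & Kl & Kr).
  assert (E0 : a i0 = b i0) by (rewrite <- H1, Hl; auto).
  assert (E1 : a i1 = b i1) by (rewrite <- H1, Hr; auto).
  exists (fun p : Prod I I => if Rle_dec (proj1_sig (snd p)) (1/2)
      then H (fst p, clampI (2 * proj1_sig (snd p)))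
      else K (fst p, clampI (2 * proj1_sig (snd p) - 1))).
  split; [|split; [|split; [|split]]]; cbn [fst snd].
  - apply (continuous_if _ _ (fun p : Prod I I => proj1_sig (snd p) : Rtop)); cont.
    + apply (continuous_comp H); auto; refine (continuous_pair (X := I) (Y := I) _ _ _ _ _); cont.
    + apply (continuous_comp K); auto; refine (continuous_pair (X := I) (Y := I) _ _ _ _ _); cont.
    + intros p ->; rewrite clampI_ge1, clampI_le0 by lra; rewrite H1, K0; auto.
  - intro s; rewrite i0_val; destruct Rle_dec; [|lra]; rewrite clampI_le0 by lra; auto.
  - intro s; rewrite i1_val; destruct Rle_dec; [lra|]; rewrite clampI_ge1 by lra; auto.
  - intro t; destruct Rle_dec; rewrite ?Hl, ?Kl; auto.
  - intro t; destruct Rle_dec; rewrite ?Hr, ?Kr; auto.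
Qed.

(** The straight-line homotopy between two clocks; [clampI] only repackages a convex combination as
    a point of [I]. *)
Definition segment (u v : I -> I) (p : Prod I I) : I :=
  clampI ((1 - proj1_sig (snd p)) * proj1_sig (u (fst p)) + proj1_sig (snd p) * proj1_sig (v (fst p))).

Lemma segment_continuous (u v : I -> I) :
  continuous u -> continuous v -> continuous (segment u v).
Proof.
  intros cu cv; unfold segment; cont.
  - apply (continuous_comp u); cont.
  - apply (continuous_comp v); cont.
Qed.

Lemma segment_0 (u v : I -> I) (s : I) : segment u v (s, i0) = u s.
Proof.
  unfold segment; cbn [fst snd]; rewrite i0_val.
  transitivity (clampI (proj1_sig (u s))); [f_equal; ring | apply clampI_id].
Qed.

Lemma segment_1 (u v : I -> I) (s : I) : segment u v (s, i1) = v s.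
Proof.
  unfold segment; cbn [fst snd]; rewrite i1_val.
  transitivity (clampI (proj1_sig (v s))); [f_equal; ring | apply clampI_id].
Qed.

Lemma segment_fixed (u v : I -> I) (s t : I) : u s = v s -> segment u v (s, t) = u s.
Proof.
  intro E; unfold segment; cbn [fst snd]; rewrite <- E.
  transitivity (clampI (proj1_sig (u s))); [f_equal; ring | apply clampI_id].
Qed.

Lemma ph_reparam {X : Space} (a : I -> X) (u v : I -> I) :
  continuous a -> continuous u -> continuous v -> u i0 = v i0 -> u i1 = v i1 ->
  path_homotopic (fun s => a (u s)) (fun s => a (v s)).
Proof.
  intros ca cu cv E0 E1; exists (fun p => a (segment u v p)); repeat split.
  - apply (continuous_comp a); auto; apply segment_continuous; auto.
  - intro s; rewrite segment_0; auto.
  - intro s; rewrite segment_1; auto.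
  - intro t; rewrite segment_fixed; auto.
  - intro t; rewrite segment_fixed; auto.
Qed.

(** * Infinite concatenation *)

(* [lam n] maps [[2^-(n+1), 2^-n]] affinely onto [[0,1]], constantly outside. *)
Definition lam (n : nat) (t : I) : I := clampI (2 ^ S n * proj1_sig t - 1).

Lemma lam_continuous (n : nat) : continuous (lam n).
Proof. unfold lam; cont. Qed.

Lemma lam_0 (n : nat) : lam n i0 = i0.
Proof. apply clampI_le0; rewrite i0_val; lra. Qed.

Lemma lam_1 (n : nat) : lam n i1 = i1.
Proof.
  apply clampI_ge1; rewrite i1_val; simpl; pose proof (pow_R1_Rle 2 n ltac:(lra)); lra.
Qed.

(** For [t > 0] take [n] with 2^n t <= 1 <= 2^(n+1) t: clocks of smaller index have not started and
    those of larger index have finished. At [t = 0] none has started. Hence loops run on these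
    clocks have disjoint supports. *)
Lemma lam_ends (t : I) :
  exists n, forall m, m <> n -> lam m t = i0 \/ lam m t = i1.
Proof.
  assert (h01 : 0 <= proj1_sig t <= 1) by (destruct t; auto).
  assert (hmono : forall i j, (i <= j)%nat -> 2 ^ i * proj1_sig t <= 2 ^ j * proj1_sig t).
  { intros; apply Rmult_le_compat_r; [lra|]; apply Rle_pow; auto; lra. }
  destruct (Req_dec (proj1_sig t) 0) as [E|ne].
  { exists O; intros m _; left; apply clampI_le0; rewrite E; lra. }
  assert (Hk : exists k, 1 <= 2 ^ S k * proj1_sig t).
  { destruct (Pow_x_infinity 2 ltac:(rewrite Rabs_pos_eq; lra) (/ proj1_sig t)) as [N hN].
    exists N; specialize (hN (S N) ltac:(lia)).
    rewrite Rabs_pos_eq in hN by (apply pow_le; lra).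
    apply Rge_le, (Rmult_le_compat_r (proj1_sig t)) in hN; [|lra].
    rewrite Rinv_l in hN by auto; exact hN. }
  (* Descend from [k] to the least exponent that works. *)
  assert (Hn : exists n, 2 ^ n * proj1_sig t <= 1 <= 2 ^ S n * proj1_sig t).
  { destruct Hk as [k hk]; induction k as [|k IH].
    - exists O; split; auto; rewrite pow_O; lra.
    - destruct (Rle_dec 1 (2 ^ S k * proj1_sig t)) as [h|h]; auto.
      exists (S k); split; auto; lra. }
  destruct Hn as (n & h1 & h2); exists n; intros m hm.
  destruct (Nat.lt_total m n) as [h|[h|h]]; [left|lia|right].
  - apply clampI_le0; pose proof (hmono (S m) n ltac:(lia)); simpl in *; lra.
  - apply clampI_ge1; pose proof (hmono (S n) m ltac:(lia)); simpl in *; lra.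
Qed.

Lemma lam_double (n : nat) (t : I) : lam n (clampI (2 * proj1_sig t)) = lam (S n) t.
Proof.
  assert (h01 : 0 <= proj1_sig t <= 1) by (destruct t; auto).
  destruct (Rle_dec (2 * proj1_sig t) 1) as [h|h].
  - unfold lam; rewrite clampI_in by lra; f_equal; simpl; ring.
  - rewrite (clampI_ge1 (2 * proj1_sig t)) by lra; rewrite lam_1.
    symmetry; apply clampI_ge1; change (2 ^ S (S n)) with (2 * (2 * 2 ^ n));
      pose proof (pow_R1_Rle 2 n ltac:(lra)); nra.
Qed.

(** The argument is the midpoint of the [n]-th interval, the time at which [continuous_pathwise]
    reads off its [n]-th point. *)
Lemma lam_mid (n : nat) : lam n (clampI (3 / 2 / 2 ^ S n)) = clampI (1 / 2).
Proof.
  unfold lam; rewrite clampI_in.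
  - f_equal; field; apply pow_nonzero; lra.
  - pose proof (pow_R1_Rle 2 n ltac:(lra)) as h.
    assert (h' : 0 < / 2 ^ n) by (apply Rinv_0_lt_compat; lra).
    assert (h1 := Rinv_le_contravar 1 _ ltac:(lra) h); rewrite Rinv_1 in h1.
    replace (3 / 2 / 2 ^ S n) with (3 / 4 * / 2 ^ n) by (simpl; field; lra); lra.
Qed.

(* The loops [a 0, a 1, ...] in succession, accumulating at [t = 0]. *)
Definition winf {X : Space} (x : X) (a : nat -> I -> X) : I -> X :=
  dsum x (fun n t => a n (lam n t)).

Lemma disjoint_supp_lam {X : Space} (x : X) (a : nat -> I -> X) :
  (forall n, a n i0 = x) -> (forall n, a n i1 = x) ->
  disjoint_supp x (fun n t => a n (lam n t)).
Proof.
  intros h0 h1 t; destruct (lam_ends t) as [n hn]; exists n; intros m hm.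
  destruct (hn m hm) as [-> | ->]; auto.
Qed.

Lemma winf_continuous {X : Space} (x : X) (a : nat -> I -> X) :
  null_sequence x a -> continuous (winf x a).
Proof.
  intros [la va]; apply dsum_continuous; auto with topo.
  - intro n; apply (continuous_comp (a n)); [apply la | apply lam_continuous].
  - intros U oU Ux; destruct (va U oU Ux) as [N hN]; exists N; auto.
  - apply disjoint_supp_lam; intro n; apply la.
Qed.

Lemma winf_ends {X : Space} (x : X) (a : nat -> I -> X) :
  (forall n, a n i0 = x) -> (forall n, a n i1 = x) -> winf x a i0 = x /\ winf x a i1 = x.
Proof.
  intros h0 h1; split; apply dsum_const; intro m; rewrite ?lam_0, ?lam_1; auto.
Qed.

Lemma winf_loop {X : Space} (x : X) (a : nat -> I -> X) :
  null_sequence x a -> is_loop (winf x a) x.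
Proof.
  intro na; split; [apply winf_continuous; auto|].
  apply winf_ends; intro n; apply na.
Qed.

(** The homotopies run side by side on the clocks [lam n]. Continuity where the clocks accumulate
    requires the whole homotopies to shrink to [x], not just their end loops. *)
Lemma winf_homotopic {X : Space} (x : X) (a b : nat -> I -> X) (H : nat -> Prod I I -> X) :
  (forall n, continuous (H n)) -> vanishing x H ->
  (forall n s, H n (s, i0) = a n s) -> (forall n s, H n (s, i1) = b n s) ->
  (forall n t, H n (i0, t) = x) -> (forall n t, H n (i1, t) = x) ->
  path_homotopic (winf x a) (winf x b).
Proof.
  intros cH vH H0 H1 Hl Hr.
  assert (al : forall n, a n i0 = x) by (intro n; rewrite <- H0; auto).
  assert (ar : forall n, a n i1 = x) by (intro n; rewrite <- H0; auto).
  destruct (winf_ends x a al ar) as [E0 E1].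
  exists (dsum x (fun n (p : Prod I I) => H n (lam n (fst p), snd p))).
  split; [|split; [|split; [|split]]].
  - apply dsum_continuous; auto with topo.
    + intro n; apply (continuous_comp (H n)); auto;
        refine (continuous_pair (X := I) (Y := I) _ _ _ _ _); cont.
    + intros U oU Ux; destruct (vH U oU Ux) as [N hN]; exists N; auto.
    + intros [s t]; destruct (lam_ends s) as [n hn]; exists n; intros m hm; cbn [fst snd].
      destruct (hn m hm) as [-> | ->]; auto.
  - intro s; unfold winf; destruct (lam_ends s) as [n hn].
    rewrite !(dsum_at x _ _ n); cbn [fst snd]; auto;
      intros m hm; destruct (hn m hm) as [-> | ->]; rewrite <- ?H0; auto.
  - intro s; unfold winf; destruct (lam_ends s) as [n hn].
    rewrite !(dsum_at x _ _ n); cbn [fst snd]; auto;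
      intros m hm; destruct (hn m hm) as [-> | ->]; rewrite <- ?H1; auto.
  - intro t; rewrite E0; apply dsum_const; intro m; cbn [fst snd]; rewrite lam_0; auto.
  - intro t; rewrite E1; apply dsum_const; intro m; cbn [fst snd]; rewrite lam_1; auto.
Qed.

(** Each homotopy stays inside the image of [a n], so the family vanishes along with [a]. *)
Lemma winf_reparam {X : Space} (x : X) (a : nat -> I -> X) (u v : nat -> I -> I) :
  null_sequence x a -> (forall n, continuous (u n)) -> (forall n, continuous (v n)) ->
  (forall n, u n i0 = i0) -> (forall n, u n i1 = i1) ->
  (forall n, v n i0 = i0) -> (forall n, v n i1 = i1) ->
  path_homotopic (winf x (fun n s => a n (u n s))) (winf x (fun n s => a n (v n s))).
Proof.
  intros [la va] cu cv u0 u1 v0 v1.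
  apply (winf_homotopic x _ _ (fun n p => a n (segment (u n) (v n) p))).
  - intro n; apply (continuous_comp (a n)); [apply la | apply segment_continuous; auto].
  - intros U oU Ux; destruct (va U oU Ux) as [N hN]; exists N; auto.
  - intros; rewrite segment_0; auto.
  - intros; rewrite segment_1; auto.
  - intros; rewrite segment_fixed, u0 by congruence; apply la.
  - intros; rewrite segment_fixed, u1 by congruence; apply la.
Qed.

Lemma winf_reparam_id {X : Space} (x : X) (a : nat -> I -> X) (u : nat -> I -> I) :
  null_sequence x a -> (forall n, continuous (u n)) ->
  (forall n, u n i0 = i0) -> (forall n, u n i1 = i1) ->
  path_homotopic (winf x (fun n s => a n (u n s))) (winf x a).
Proof.
  intros; apply (winf_reparam x a u (fun _ s => s)); auto; intro; apply continuous_id.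
Qed.

Lemma open_near_i0 (V : I -> Prop) : isOpen V -> V i0 ->
  exists d, d > 0 /\ forall r, 0 <= r < d -> V (clampI r).
Proof.
  intros oV V0; destruct (oV _ V0) as (A & oA & A0 & hA).
  destruct (oA _ A0) as (d & hd & h); exists d; split; auto; intros r hr.
  apply hA, h; rewrite i0_val, clampI_val.
  rewrite Rminus_0_r, Rabs_pos_eq by apply Rmax_l.
  unfold Rmax, Rmin; repeat destruct Rle_dec; lra.
Qed.

(* [I x I] is first countable and locally path connected: points converging to
   [p] all lie on one path, made of a null sequence of segments issued from [p]. *)
Lemma continuous_pathwise {X : Space} (h : Prod I I -> X) :
  (forall c : I -> Prod I I, continuous c -> continuous (fun t => h (c t))) -> continuous h.
Proof.
  intro hc; apply continuous_local; auto with topo; intros p U oU Up.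
  apply NNPP; intro contra.
  assert (Hq : forall n : nat, exists q : I * I,
    Rabs (proj1_sig (fst q) - proj1_sig (fst p)) < / INR (S n) /\
    Rabs (proj1_sig (snd q) - proj1_sig (snd p)) < / INR (S n) /\ ~ U (h q)).
  { intro n; apply NNPP; intro no; apply contra.
    exists (fun q : Prod I I => Rabs (proj1_sig (fst q) - proj1_sig (fst p)) < / INR (S n) /\
      Rabs (proj1_sig (snd q) - proj1_sig (snd p)) < / INR (S n)).
    assert (hn : / INR (S n) > 0) by (apply Rinv_0_lt_compat, lt_0_INR; lia).
    split; [|split].
    - apply (proj1 (proj2 II_topology)).
      + apply (open_ball_R (fun q : Prod I I => proj1_sig (fst q))); cont.
      + apply (open_ball_R (fun q : Prod I I => proj1_sig (snd q))); cont.
    - rewrite !Rminus_diag, Rabs_R0; auto.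
    - intros q [h1 h2]; apply NNPP; intro nU; apply no; exists q; auto. }
  destruct (choice _ Hq) as [q hq]; clear Hq.
  (* The factor 4s(1-s) climbs from 0 to 1 at s = 1/2 and falls back, so a leg goes from [y] to [z]
     and returns. *)
  set (leg := fun (y z s : I) => clampI (proj1_sig y +
        4 * proj1_sig s * (1 - proj1_sig s) * (proj1_sig z - proj1_sig y))).
  assert (leg0 : forall y z, leg y z i0 = y).
  { intros; unfold leg; transitivity (clampI (proj1_sig y));
      [f_equal; rewrite i0_val; ring | apply clampI_id]. }
  assert (leg1 : forall y z, leg y z i1 = y).
  { intros; unfold leg; transitivity (clampI (proj1_sig y));
      [f_equal; rewrite i1_val; ring | apply clampI_id]. }
  assert (leg2 : forall y z, leg y z (clampI (1 / 2)) = z).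
  { intros; unfold leg; transitivity (clampI (proj1_sig z));
      [f_equal; rewrite clampI_in by lra; field | apply clampI_id]. }
  assert (legd : forall y z s, Rabs (proj1_sig (leg y z s) - proj1_sig y)
                               <= Rabs (proj1_sig z - proj1_sig y)).
  { intros y z s; unfold leg; destruct y as [y hy], z as [z hz], s as [s hs];
      cbn in y, hy, z, hz, s, hs; cbn [proj1_sig].
    assert (h4 : 0 <= 4 * s * (1 - s) <= 1)
      by (pose proof (Rle_0_sqr (2 * s - 1)); unfold Rsqr in *; split; nra).
    set (k := 4 * s * (1 - s)) in *.
    rewrite clampI_in by nra.
    replace (y + k * (z - y) - y) with (k * (z - y)) by ring.
    rewrite Rabs_mult, (Rabs_pos_eq k) by lra.
    pose proof (Rabs_pos (z - y)); nra. }
  set (a := fun n (s : I) => ((leg (fst p) (fst (q n)) s, leg (snd p) (snd (q n)) s) : Prod I I)).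
  assert (a0 : forall n, a n i0 = p) by (intro; unfold a; rewrite !leg0; destruct p; auto).
  assert (a1 : forall n, a n i1 = p) by (intro; unfold a; rewrite !leg1; destruct p; auto).
  assert (na : null_sequence (X := Prod I I) p a).
  { split.
    - intro n; split; auto; refine (continuous_pair (X := I) (Y := I) _ _ _ _ _); unfold leg; cont.
    - intros V oV Vp; destruct (oV p Vp) as (A & B & oA & oB & Ap & Bp & hV).
      destruct (oA _ Ap) as (A' & oA' & Ap' & hA), (oB _ Bp) as (B' & oB' & Bp' & hB).
      destruct (oA' _ Ap') as (d1 & hd1 & hA'), (oB' _ Bp') as (d2 & hd2 & hB').
      destruct (archimed_cor1 (Rmin d1 d2) (Rmin_pos _ _ hd1 hd2)) as (N & hN & N0).
      exists N; intros n hn s.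
      assert (hinv : / INR (S n) < Rmin d1 d2).
      { eapply Rle_lt_trans; [|exact hN]; apply Rinv_le_contravar;
          [apply lt_0_INR; lia | apply le_INR; lia]. }
      destruct (hq n) as (h1 & h2 & _).
      apply hV; [apply hA, hA' | apply hB, hB']; cbn [fst snd a].
      + eapply Rle_lt_trans; [apply legd|]; pose proof (Rmin_l d1 d2); lra.
      + eapply Rle_lt_trans; [apply legd|]; pose proof (Rmin_r d1 d2); lra. }
  (* This path has value [p] at time 0 and passes through [q n] at the midpoint of the [n]-th
     interval, where [h] leaves [U]: a contradiction once that midpoint is below [d]. *)
  assert (ch := hc _ (winf_continuous _ _ na)).
  destruct (open_near_i0 _ (ch U oU)) as (d & hd & hV).
  { rewrite (proj1 (winf_ends (X := Prod I I) p a a0 a1)); auto. }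
  destruct (Pow_x_infinity 2 ltac:(rewrite Rabs_pos_eq; lra) (2 / d)) as [n hn].
  specialize (hn (S n) ltac:(lia)); rewrite Rabs_pos_eq in hn by (apply pow_le; lra).
  apply (proj2 (proj2 (hq n))).
  assert (h2 : 2 ^ S n > 0) by (apply pow_lt; lra).
  specialize (hV (3 / 2 / 2 ^ S n)); unfold winf in hV.
  rewrite (dsum_at _ _ _ n), lam_mid in hV.
  - unfold a in hV; rewrite !leg2 in hV; destruct (q n); apply hV; split.
    + apply Rlt_le, Rdiv_lt_0_compat; lra.
    + apply (Rmult_lt_reg_r (2 ^ S n)); auto; unfold Rdiv at 1; rewrite Rmult_assoc, Rinv_l by lra.
      apply Rge_le, (Rmult_le_compat_l d) in hn; [|lra].
      replace (d * (2 / d)) with 2 in hn by (field; lra); lra.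
  (* The active index can only be [n], since [lam n] is 1/2 at this time and hence at neither
     end. *)
  - intros m hm; destruct (lam_ends (clampI (3 / 2 / 2 ^ S n))) as [k hk].
    destruct (Nat.eq_dec n k) as [->|ne].
    + destruct (hk m hm) as [-> | ->]; auto.
    + exfalso; destruct (hk n ne) as [E|E]; rewrite lam_mid in E;
        apply (f_equal (@proj1_sig _ _)) in E; rewrite clampI_in in E by lra;
        rewrite ?i0_val, ?i1_val in E; lra.
Qed.

(** * Loops in a pre-Delta-monoid *)

(** Upgrades the axiom from paths to maps on the square, which is what makes [op] act on homotopy
    classes. *)
Lemma op_continuous {M : Space} {op : M -> M -> M} {e : M} (h k : Prod I I -> M) :
  pre_delta_monoid M op e -> continuous h -> continuous k ->
  continuous (fun p => op (h p) (k p)).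
Proof.
  intros (_ & _ & hop) ch ck; apply continuous_pathwise; intros c cc.
  apply (hop (fun t => h (c t)) (fun t => k (c t)));
    [apply (continuous_comp h) | apply (continuous_comp k)]; auto.
Qed.

Lemma op_loop {M : Space} {op : M -> M -> M} {e : M} (a b : I -> M) :
  pre_delta_monoid M op e -> is_loop a e -> is_loop b e -> is_loop (fun t => op (a t) (b t)) e.
Proof.
  intros (_ & hid & hop) (ca & a0 & a1) (cb & b0 & b1).
  split; [|split]; rewrite ?a0, ?a1, ?b0, ?b1; try apply hid; auto.
Qed.

Lemma ph_op {M : Space} {op : M -> M -> M} {e : M} (a a' b b' : I -> M) :
  pre_delta_monoid M op e -> path_homotopic a a' -> path_homotopic b b' ->
  path_homotopic (fun t => op (a t) (b t)) (fun t => op (a' t) (b' t)).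
Proof.
  intros hM (H & cH & H0 & H1 & Hl & Hr) (K & cK & K0 & K1 & Kl & Kr).
  exists (fun p => op (H p) (K p)); split; [apply (op_continuous H K hM); auto|].
  repeat split; intro; rewrite ?H0, ?H1, ?Hl, ?Hr, ?K0, ?K1, ?Kl, ?Kr; auto.
Qed.

(* Eckmann-Hilton: shrink [a] to [[0,1/2]] and [b] to [[1/2,1]]. *)
Lemma concat_op {M : Space} {op : M -> M -> M} {e : M} (a b : I -> M) (t : I) :
  pre_delta_monoid M op e -> is_loop a e -> is_loop b e ->
  concat a b t = op (a (clampI (2 * proj1_sig t))) (b (clampI (2 * proj1_sig t - 1))).
Proof.
  intros (_ & hid & _) (ca & a0 & a1) (cb & b0 & b1); unfold concat; destruct Rle_dec; symmetry.
  - rewrite (clampI_le0 (2 * proj1_sig t - 1)), b0 by lra; apply hid.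
  - rewrite (clampI_ge1 (2 * proj1_sig t)), a1 by lra; apply hid.
Qed.

Lemma ph_op_concat {M : Space} {op : M -> M -> M} {e : M} (a b : I -> M) :
  pre_delta_monoid M op e -> is_loop a e -> is_loop b e ->
  path_homotopic (fun t => op (a t) (b t)) (concat a b).
Proof.
  intros hM la lb.
  replace (concat a b) with
    (fun t : I => op (a (clampI (2 * proj1_sig t))) (b (clampI (2 * proj1_sig t - 1))))
    by (apply functional_extensionality; intro; symmetry; apply (concat_op _ _ _ hM); auto).
  apply (ph_op _ _ _ _ hM).
  - apply (ph_reparam a (fun t => t) (fun t => clampI (2 * proj1_sig t))); cont; [apply la|..].
    + rewrite i0_val, clampI_le0 by lra; auto.
    + rewrite i1_val, clampI_ge1 by lra; auto.
  - apply (ph_reparam b (fun t => t) (fun t => clampI (2 * proj1_sig t - 1))); cont; [apply lb|..].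
    + rewrite i0_val, clampI_le0 by lra; auto.
    + rewrite i1_val, clampI_ge1 by lra; auto.
Qed.

(** Going along [b] and back is [b] composed with a tent function from 0 to 0, and in the interval
    such a clock contracts to the constant one. *)
Lemma concat_reverse {X : Space} (x : X) (b : I -> X) : is_loop b x ->
  path_homotopic (concat b (fun t => b (clampI (1 - proj1_sig t)))) (fun _ => x).
Proof.
  intros (cb & b0 & b1).
  set (tent := fun t : I =>
    clampI (proj1_sig (clampI (2 * proj1_sig t)) - proj1_sig (clampI (2 * proj1_sig t - 1)))).
  replace (concat b _) with (fun t => b (tent t)).
  - replace (fun _ : I => x) with (fun t : I => b i0) by (rewrite b0; auto).
    apply (ph_reparam b tent (fun _ => i0)); unfold tent; cont.
    + rewrite i0_val, (clampI_le0 (2 * 0)), (clampI_le0 (2 * 0 - 1)) by lra.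
      apply clampI_le0; lra.
    + rewrite i1_val, (clampI_ge1 (2 * 1)), (clampI_ge1 (2 * 1 - 1)) by lra.
      apply clampI_le0; lra.
  - apply functional_extensionality; intro t; unfold concat, tent; destruct Rle_dec.
    + rewrite (clampI_le0 (2 * proj1_sig t - 1)), i0_val, Rminus_0_r, clampI_id by lra; auto.
    + rewrite (clampI_ge1 (2 * proj1_sig t)), i1_val by lra; auto.
Qed.

(** Multiply on the right by the reverse of [b], which by [ph_op_concat] and [concat_reverse] is an
    inverse for [op] up to homotopy. *)
Lemma ph_op_cancel {M : Space} {op : M -> M -> M} {e : M} (a b c : I -> M) :
  pre_delta_monoid M op e -> is_loop a e -> is_loop b e -> is_loop c e ->
  path_homotopic (fun t => op (a t) (b t)) (fun t => op (c t) (b t)) -> path_homotopic a c.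
Proof.
  intros hM la lb lc hab.
  set (b' := fun t : I => b (clampI (1 - proj1_sig t))).
  assert (lb' : is_loop b' e).
  { destruct lb as (cb & b0 & b1); unfold b'; split; [|split].
    - apply (continuous_comp b); cont.
    - rewrite i0_val, clampI_ge1 by lra; auto.
    - rewrite i1_val, clampI_le0 by lra; auto. }
  assert (hinv : path_homotopic (fun t => op (b t) (b' t)) (fun _ => e)).
  { eapply ph_trans; [apply (ph_op_concat b b' hM); auto|]; apply concat_reverse; auto. }
  assert (drop : forall d, is_loop d e ->
    path_homotopic (fun t => op (op (d t) (b t)) (b' t)) d).
  { intros d ld; assert (hM' := hM); destruct hM' as (hassoc & hid & hop).
    replace (fun t => op (op (d t) (b t)) (b' t)) with (fun t => op (d t) (op (b t) (b' t)))
      by (apply functional_extensionality; auto).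
    assert (E : (fun t => op (d t) e) = d)
      by (apply functional_extensionality; intro; apply hid).
    pose proof (ph_op d d _ (fun _ => e) hM (ph_refl d (proj1 ld)) hinv) as P.
    cbn beta in P; rewrite E in P; exact P. }
  apply ph_trans with (fun t => op (op (a t) (b t)) (b' t)).
  - apply (ph_sym_loop e); auto; apply (op_loop (fun t => op (a t) (b t)) b' hM); auto.
    apply (op_loop a b hM); auto.
  - eapply ph_trans; [|apply drop; auto].
    apply (ph_op (fun t => op (a t) (b t)) (fun t => op (c t) (b t)) b' b' hM); auto.
    apply ph_refl, lb'.
Qed.

Lemma dsum_split {X M : Space} {op : M -> M -> M} {e : M} (a : nat -> X -> M) (t : X) :
  pre_delta_monoid M op e -> disjoint_supp e a ->
  dsum e a t = op (a 0%nat t) (dsum e (fun n => a (S n)) t).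
Proof.
  intros (_ & hid & _) da; destruct (da t) as [[|n] hn].
  - rewrite (dsum_at e a t 0 hn), dsum_const by (intro; apply hn; lia); symmetry; apply hid.
  - rewrite (dsum_at e a t (S n) hn), (dsum_at e _ t n), (hn 0%nat)
      by (intros; try apply hn; lia); symmetry; apply hid.
Qed.

(** Both concatenations run on the same clocks [lam n], so the interchange is an equality at every
    time. *)
Lemma winf_op {M : Space} {op : M -> M -> M} {e : M} (a b : nat -> I -> M) (t : I) :
  pre_delta_monoid M op e -> (forall n, is_loop (a n) e) -> (forall n, is_loop (b n) e) ->
  winf e (fun n s => op (a n s) (b n s)) t = op (winf e a t) (winf e b t).
Proof.
  intros (_ & hid & _) la lb; unfold winf; destruct (lam_ends t) as [n hn].
  assert (E : forall m, m <> n -> a m (lam m t) = e /\ b m (lam m t) = e).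
  { intros m hm; destruct (la m) as (_ & ? & ?), (lb m) as (_ & ? & ?).
    destruct (hn m hm) as [-> | ->]; auto. }
  rewrite !(dsum_at e _ t n); auto; intros m hm; destruct (E m hm) as [Ea Eb]; auto.
  rewrite Ea, Eb; apply hid.
Qed.

Lemma null_sequence_tail {X : Space} (x : X) (a : nat -> I -> X) :
  null_sequence x a -> null_sequence x (fun n => a (S n)).
Proof.
  intros [la va]; split; auto; intros U oU Ux; destruct (va U oU Ux) as [N hN].
  exists N; intros; apply hN; lia.
Qed.

(** [a 0] occupies [1/2,1] and the sped-up tail [0,1/2]. At every time one of the two factors is
    [e], so [op] reassembles them whatever their order in time; then both clocks are relaxed to full
    length. *)
Lemma winf_shift {M : Space} {op : M -> M -> M} {e : M} (a : nat -> I -> M) :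
  pre_delta_monoid M op e -> null_sequence e a ->
  path_homotopic (winf e a) (fun t => op (a 0%nat t) (winf e (fun n => a (S n)) t)).
Proof.
  intros hM na; assert (na' := null_sequence_tail _ _ na).
  replace (winf e a) with
    (fun t : I => op (a 0%nat (lam 0 t)) (winf e (fun n => a (S n)) (clampI (2 * proj1_sig t)))).
  - apply (ph_op _ _ _ _ hM).
    + apply (ph_reparam (a 0%nat) (lam 0) (fun t => t)); cont.
      * apply na.
      * apply lam_0.
      * apply lam_1.
    + apply (ph_reparam (winf e (fun n => a (S n))) (fun t => clampI (2 * proj1_sig t)) (fun t => t));
        cont.
      * apply winf_continuous; auto.
      * rewrite i0_val; apply clampI_le0; lra.
      * rewrite i1_val; apply clampI_ge1; lra.
  - apply functional_extensionality; intro t; unfold winf at 2.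
    rewrite (dsum_split _ t hM).
    + f_equal; apply dsum_ext; intro n; rewrite lam_double; auto.
    + apply disjoint_supp_lam; intro n; apply na.
Qed.

(* Eilenberg swindle: with [R n] the sum of the [a k], [k >= n], one has
   [R n = a n * R (n+1)]; so [R 0 * (R 1 R 2 ...)] and [(a 0 a 1 ...) * (R 1 R 2 ...)]
   are both homotopic to [R 0 R 1 R 2 ...]. *)
Lemma dsum_homotopic_winf {M : Space} {op : M -> M -> M} {e : M} (a : nat -> I -> M) :
  pre_delta_monoid M op e -> null_sequence e a -> disjoint_supp e a ->
  path_homotopic (dsum e a) (winf e a).
Proof.
  intros hM na da; assert (va := proj2 na : vanishing e a).
  set (R := fun n => dsum e (fun k => a (n + k)%nat)).
  assert (nR : null_sequence e R).
  { split; [|exact (vanishing_tails e a va da)].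
    intro n; split; [|split].
    - apply dsum_continuous; auto with topo; [intro; apply na| |apply disjoint_supp_shift; auto].
      intros U oU Ue; destruct (va U oU Ue) as [N hN]; exists N; intros; apply hN; lia.
    - apply dsum_const; intro; apply na.
    - apply dsum_const; intro; apply na. }
  assert (nR' := null_sequence_tail _ _ nR).
  assert (hR : forall n t, R n t = op (a n t) (R (S n) t)).
  { intros n t; unfold R at 1.
    rewrite (dsum_split _ t hM) by (apply disjoint_supp_shift; auto).
    rewrite Nat.add_0_r; f_equal; unfold R.
    replace (fun k => a (n + S k)%nat) with (fun k => a (S n + k)%nat); auto.
    apply functional_extensionality; intro; f_equal; lia. }
  apply (ph_op_cancel _ (winf e (fun n => R (S n))) _ hM).
  - exact (proj1 nR 0%nat).
  - apply winf_loop; auto.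
  - apply winf_loop; auto.
  - apply ph_trans with (winf e R).
    + apply (ph_sym_loop e); [apply winf_loop; auto| |exact (winf_shift R hM nR)].
      apply (op_loop _ _ hM (proj1 nR 0%nat) (winf_loop _ _ nR')).
    + replace (fun t => op (winf e a t) (winf e (fun n => R (S n)) t)) with (winf e R).
      * apply ph_refl, winf_continuous; auto.
      * apply functional_extensionality; intro t; rewrite <- (winf_op a _ t hM);
          [|apply na|apply nR'].
        replace R with (fun n s => op (a n s) (R (S n) s)) at 1; auto.
        do 2 (apply functional_extensionality; intro); auto.
Qed.

(** * The gaps of the Cantor set *)

Lemma div2_lt_pow (j p : nat) : (p < 2 ^ S j)%nat -> (Nat.div2 p < 2 ^ j)%nat.
Proof.
  rewrite (Nat.div2_odd p) at 1; cbn [Nat.pow]; lia.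
Qed.

Lemma inv_pow3 (j : nat) : / 3 ^ j = 3 * / 3 ^ S j.
Proof. simpl; rewrite Rinv_mult; lra. Qed.

(** An interval left after [j] stages of the Cantor construction, without its right end; the gap
    [(j, p)] is its open middle third. *)
Definition cell (j p : nat) (t : R) : Prop := gap_off j p <= t < gap_off j p + / 3 ^ j.

(** Halving [p] drops the last binary digit, and this digit says whether the cell is the right or
    the left third of its parent. *)
Lemma cell_parent (j p : nat) (t : R) : cell (S j) p t ->
  cell j (Nat.div2 p) t /\
  (if Nat.odd p then gap_off j (Nat.div2 p) + 2 / 3 ^ S j <= t
   else t < gap_off j (Nat.div2 p) + / 3 ^ S j).
Proof.
  unfold cell; cbn [gap_off].
  assert (h : 0 < / 3 ^ S j) by (apply Rinv_0_lt_compat, pow_lt; lra).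
  rewrite (inv_pow3 j).
  unfold Rdiv; destruct (Nat.odd p); lra.
Qed.

Lemma cell_unique (j p q : nat) (t : R) : (p < 2 ^ j)%nat -> (q < 2 ^ j)%nat ->
  cell j p t -> cell j q t -> p = q.
Proof.
  revert p q; induction j as [|j IH]; intros p q hp hq cp cq; [simpl in *; lia|].
  apply cell_parent in cp as [cp hp'], cq as [cq hq'].
  pose proof (Nat.div2_odd p) as Ep; pose proof (Nat.div2_odd q) as Eq.
  assert (E : Nat.div2 p = Nat.div2 q).
  { apply IH; auto; apply div2_lt_pow; auto. }
  assert (h : 0 < / 3 ^ S j) by (apply Rinv_0_lt_compat, pow_lt; lra).
  rewrite Ep, Eq, E; rewrite E in hp'; unfold Rdiv in *.
  destruct (Nat.odd p), (Nat.odd q); auto; lra.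
Qed.

Lemma cell_ancestor (d j p : nat) (t : R) : (p < 2 ^ (d + j))%nat -> cell (d + j) p t ->
  exists q, (q < 2 ^ j)%nat /\ cell j q t.
Proof.
  revert p; induction d as [|d IH]; intros p hp cp; [exists p; auto|].
  apply (IH (Nat.div2 p)).
  - apply div2_lt_pow; auto.
  - apply (cell_parent (d + j) p t cp).
Qed.

Lemma in_gap_cell (j p : nat) (t : R) : in_gap j p t ->
  cell j p t /\ gap_off j p + / 3 ^ S j < t < gap_off j p + 2 / 3 ^ S j.
Proof.
  intros [_ [h1 h2]]; unfold cell, gap_left in *.
  assert (h : 0 < / 3 ^ S j) by (apply Rinv_0_lt_compat, pow_lt; lra).
  rewrite (inv_pow3 j).
  unfold Rdiv; lra.
Qed.

(** A gap of a deeper level lies in a cell of level [S j], that is, in an outer third of a level-[j]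
    cell, whereas [in_gap j p t] puts [t] in a middle third. *)
Lemma in_gap_level (j p d q : nat) (t : R) : in_gap j p t -> ~ in_gap (d + S j) q t.
Proof.
  intros gp gq.
  destruct (cell_ancestor d (S j) q t (proj1 gq) (proj1 (in_gap_cell _ _ _ gq))) as (r & hr & cr).
  apply cell_parent in cr as [cr hr'].
  apply in_gap_cell in gp as hg; destruct hg as [cp hp].
  assert (E : Nat.div2 r = p).
  { apply (cell_unique j _ _ t); auto; [|apply gp].
    apply div2_lt_pow; auto. }
  rewrite E in hr'; unfold Rdiv in *; destruct (Nat.odd r); lra.
Qed.

Lemma in_gap_unique (j p j' p' : nat) (t : R) :
  in_gap j p t -> in_gap j' p' t -> j = j' /\ p = p'.
Proof.
  intros g g'; destruct (Nat.lt_total j j') as [h|[<-|h]].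
  - exfalso; apply (in_gap_level j p (j' - S j) p' t g).
    replace (j' - S j + S j)%nat with j' by lia; auto.
  - split; auto; apply (cell_unique j _ _ t); [apply g|apply g'|apply in_gap_cell..]; auto.
  - exfalso; apply (in_gap_level j' p' (j - S j') p t g').
    replace (j - S j' + S j')%nat with j by lia; auto.
Qed.

Lemma gap_off_bounds (j p : nat) : 0 <= gap_off j p <= 1 - / 3 ^ j.
Proof.
  revert p; induction j as [|j IH]; intro p; cbn [gap_off]; [simpl; lra|].
  specialize (IH (Nat.div2 p)).
  assert (h : 0 < / 3 ^ S j) by (apply Rinv_0_lt_compat, pow_lt; lra).
  rewrite (inv_pow3 j) in IH.
  unfold Rdiv; destruct (Nat.odd p); lra.
Qed.

(** With [position], the inverse of [gap_index]: S n = 2^j + p with p < 2^j forces [j] to be the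
    binary logarithm. *)
Definition level (n : nat) : nat := Nat.log2 (S n).
Definition position (n : nat) : nat := (S n - 2 ^ level n)%nat.

Lemma position_lt (n : nat) : (position n < 2 ^ level n)%nat.
Proof.
  unfold position, level; destruct (Nat.log2_spec (S n) ltac:(lia)) as [_ h].
  cbn [Nat.pow] in h; lia.
Qed.

Lemma gap_index_level (n : nat) : gap_index (level n) (position n) = n.
Proof.
  unfold gap_index, position, level; destruct (Nat.log2_spec (S n) ltac:(lia)); lia.
Qed.

Lemma level_gap_index (j p : nat) : (p < 2 ^ j)%nat ->
  level (gap_index j p) = j /\ position (gap_index j p) = p.
Proof.
  intro hp; assert (h := Nat.pow_nonzero 2 j ltac:(lia)); unfold gap_index.
  assert (E : level (2 ^ j + p - 1) = j) by (apply Nat.log2_unique; cbn [Nat.pow]; lia).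
  unfold position; rewrite E; lia.
Qed.

(** The affine clock of [tprod] on the [n]-th gap, extended by constants outside it, so that it can
    enter a [dsum]. *)
Definition gap_coord (n : nat) (t : I) : I :=
  clampI ((proj1_sig t - gap_left (level n) (position n)) * 3 ^ S (level n)).

Lemma gap_coord_continuous (n : nat) : continuous (gap_coord n).
Proof. unfold gap_coord; cont. Qed.

Lemma gap_coord_outside (n : nat) (t : I) :
  ~ in_gap (level n) (position n) (proj1_sig t) -> gap_coord n t = i0 \/ gap_coord n t = i1.
Proof.
  intro h; unfold gap_coord; set (g := gap_left _ _).
  assert (h3 : 0 < 3 ^ S (level n)) by (apply pow_lt; lra).
  destruct (Rle_dec (proj1_sig t) g) as [h1|h1].
  - left; apply clampI_le0; nra.
  - right; apply clampI_ge1.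
    assert (h2 : g + / 3 ^ S (level n) <= proj1_sig t).
    { apply Rnot_lt_le; intro; apply h; split; [apply position_lt|fold g; lra]. }
    apply (Rmult_le_reg_r (/ 3 ^ S (level n))); [apply Rinv_0_lt_compat; auto|].
    rewrite Rmult_assoc, Rinv_r; lra.
Qed.

Lemma gap_coord_0 (n : nat) : gap_coord n i0 = i0.
Proof.
  apply clampI_le0; rewrite i0_val; unfold gap_left.
  pose proof (gap_off_bounds (level n) (position n)).
  assert (h3 : 0 < 3 ^ S (level n)) by (apply pow_lt; lra).
  pose proof (Rinv_0_lt_compat _ h3); nra.
Qed.

Lemma gap_coord_1 (n : nat) : gap_coord n i1 = i1.
Proof.
  destruct (gap_coord_outside n i1) as [E|]; auto.
  - intros [_ [_ h]]; rewrite i1_val in h; unfold gap_left in h.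
    pose proof (gap_off_bounds (level n) (position n)).
    assert (h3 : 0 < / 3 ^ S (level n)) by (apply Rinv_0_lt_compat, pow_lt; lra).
    rewrite (inv_pow3 (level n)) in *; lra.
  - exfalso; apply (f_equal (@proj1_sig _ _)) in E; unfold gap_coord in E.
    rewrite i0_val, i1_val in E.
    pose proof (gap_off_bounds (level n) (position n)).
    assert (h3 : 0 < 3 ^ S (level n)) by (apply pow_lt; lra).
    assert (h4 : 0 < / 3 ^ S (level n)) by (apply Rinv_0_lt_compat; auto).
    rewrite clampI_ge1, i1_val in E; [lra|]; unfold gap_left.
    apply (Rmult_le_reg_r (/ 3 ^ S (level n))); auto; rewrite Rmult_assoc, Rinv_r by lra.
    rewrite (inv_pow3 (level n)) in *; lra.
Qed.

Lemma disjoint_gap_coord {X : Space} (x : X) (a : nat -> I -> X) :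
  (forall n, is_loop (a n) x) -> disjoint_supp x (fun n t => a n (gap_coord n t)).
Proof.
  intros la t.
  assert (out : forall m, ~ in_gap (level m) (position m) (proj1_sig t) -> a m (gap_coord m t) = x).
  { intros m hm; destruct (la m) as (_ & a0 & a1).
    destruct (gap_coord_outside m t hm) as [-> | ->]; auto. }
  destruct (classic (exists n, in_gap (level n) (position n) (proj1_sig t))) as [[n hn]|h].
  - exists n; intros m hm; apply out; intro g; apply hm.
    destruct (in_gap_unique _ _ _ _ _ g hn) as [E1 E2].
    rewrite <- (gap_index_level m), E1, E2; apply gap_index_level.
  - exists O; intros m _; apply out; intro; apply h; eauto.
Qed.

(** Each time lies in at most one gap, and loops whose gap is missed sit at an end of their clock,
    so both choices select the same value. *)
Lemma tprod_dsum {X : Space} (x : X) (a : nat -> I -> X) : (forall n, is_loop (a n) x) ->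
  tprod x a = dsum x (fun n t => a n (gap_coord n t)).
Proof.
  intro la; apply functional_extensionality; intro t; unfold tprod; set (P := fun v => _ \/ _).
  assert (out : forall m, ~ in_gap (level m) (position m) (proj1_sig t) -> a m (gap_coord m t) = x).
  { intros m hm; destruct (la m) as (_ & a0 & a1).
    destruct (gap_coord_outside m t hm) as [-> | ->]; auto. }
  assert (E : P (epsilon (inhabits x) P)).
  { apply epsilon_spec; unfold P.
    destruct (classic (exists j p, in_gap j p (proj1_sig t))) as [(j & p & h)|h].
    - eexists; left; exists j, p; split; [exact h|reflexivity].
    - exists x; right; split; auto; intros j p g; apply h; eauto. }
  destruct E as [(j & p & g & ->)|[h ->]].
  - assert (hp := proj1 g); destruct (level_gap_index j p hp) as [E1 E2].
    rewrite (dsum_at x _ t (gap_index j p)).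
    + unfold gap_coord; rewrite E1, E2; auto.
    + intros m hm; apply out; intro g'; apply hm.
      destruct (in_gap_unique _ _ _ _ _ g g') as [E3 E4].
      rewrite E3, E4; symmetry; apply gap_index_level.
  - symmetry; apply dsum_const; auto.
Qed.

(** * Transfinite commutativity *)

Lemma dsum_permute {X Y : Space} (x : Y) (a : nat -> X -> Y) (f g : nat -> nat) :
  disjoint_supp x a -> (forall n, f (g n) = n) -> (forall n, g (f n) = n) ->
  dsum x (fun n => a (f n)) = dsum x a.
Proof.
  intros da fg gf; apply functional_extensionality; intro t; destruct (da t) as [n hn].
  rewrite (dsum_at x a t n hn), (dsum_at x _ t (g n)), fg; auto.
  intros m hm; apply hn; intros <-; auto.
Qed.

Lemma bijective_nat_inverse (f : nat -> nat) : bijective_nat f ->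
  exists g, (forall n, f (g n) = n) /\ (forall n, g (f n) = n).
Proof.
  intros [inj surj]; destruct (choice _ surj) as [g hg]; exists g; auto.
Qed.

Lemma null_sequence_reparam {X : Space} (x : X) (a : nat -> I -> X) (u : nat -> I -> I) :
  null_sequence x a -> (forall n, continuous (u n)) ->
  (forall n, u n i0 = i0) -> (forall n, u n i1 = i1) ->
  null_sequence x (fun n t => a n (u n t)).
Proof.
  intros [la va] cu u0 u1; split.
  - intro n; destruct (la n) as (ca & a0 & a1); split; [|rewrite u0, u1; auto].
    apply (continuous_comp (a n)); auto.
  - intros U oU Ux; destruct (va U oU Ux) as [N hN]; exists N; auto.
Qed.

Lemma pre_delta_monoid_transfinitely_commutative {M : Space} {op : M -> M -> M} {e : M} :
  pre_delta_monoid M op e -> transfinitely_pi1_commutative e.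
Proof.
  intros hM a na phi hphi.
  destruct (bijective_nat_inverse phi hphi) as (psi & h1 & h2).
  (* [a n] may be placed in the [h n]-th gap, whatever the bijection [h]. *)
  assert (key : forall h h' : nat -> nat, (forall n, h (h' n) = n) -> (forall n, h' (h n) = n) ->
    disjoint_supp e (fun n t => a n (gap_coord (h n) t)) /\
    path_homotopic (dsum e (fun n t => a n (gap_coord (h n) t))) (winf e a)).
  { intros h h' E E'.
    assert (d : disjoint_supp e (fun n t => a n (gap_coord (h n) t))).
    (* Relabelled by [h'], this is the family of [disjoint_gap_coord], with its [n]-th loop in the
       [n]-th gap. *)
    { intro t; destruct (disjoint_gap_coord e (fun n => a (h' n)) (fun n => proj1 na (h' n)) t)
        as [n hn].
      exists (h' n); intros m hm; specialize (hn (h m)); cbn beta in hn; rewrite E' in hn.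
      apply hn; intros <-; auto. }
    split; auto; eapply ph_trans; [apply (dsum_homotopic_winf _ hM); auto|].
    - apply (null_sequence_reparam e a (fun n => gap_coord (h n))); auto; intro n;
        [apply gap_coord_continuous|apply gap_coord_0|apply gap_coord_1].
    - apply (winf_reparam_id e a (fun n => gap_coord (h n))); auto; intro n;
        [apply gap_coord_continuous|apply gap_coord_0|apply gap_coord_1]. }
  destruct (key (fun n => n) (fun n => n)) as [_ k1]; auto.
  destruct (key psi phi) as [d k2]; auto.
  (* Placing [a (phi n)] in gap [n] is placing [a m] in gap [psi m]: the loops stay and the gaps are
     permuted, so both products are compared with the same [winf e a]. *)
  assert (E : tprod e (fun n => a (phi n)) = dsum e (fun n t => a n (gap_coord (psi n) t))).
  { rewrite <- (dsum_permute e (fun n t => a n (gap_coord (psi n) t)) phi psi d h1 h2).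
    rewrite tprod_dsum by (intro; apply na); f_equal.
    apply functional_extensionality; intro n; rewrite h2; auto. }
  rewrite E, tprod_dsum by (intro; apply na).
  assert (ends : forall s, s = i0 \/ s = i1 -> winf e a s = e /\
     dsum e (fun n t => a n (gap_coord (psi n) t)) s = e).
  { intros s [-> | ->]; split; try apply (winf_loop e a na); apply dsum_const; intro m;
      rewrite ?gap_coord_0, ?gap_coord_1; apply na. }
  eapply ph_trans; [exact k1|]; apply ph_sym; auto.
  - destruct (ends i0); auto; congruence.
  - destruct (ends i1); auto; congruence.
Qed.

(** * The Hawaiian earring and the infinite torus *)

Lemma S1_topology : is_topology S1.
Proof. apply Sub_topology, R2top_topology. Qed.

Lemma HE_topology : is_topology HE.
Proof. apply Sub_topology, R2top_topology. Qed.

#[local] Hint Resolve S1_topology HE_topology : topo.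

Lemma sqrt_norm_le (a b : R) : sqrt (a ^ 2 + b ^ 2) <= Rabs a + Rabs b.
Proof.
  pose proof (Rabs_pos a); pose proof (Rabs_pos b).
  rewrite <- (sqrt_pow2 (Rabs a + Rabs b)) by lra; apply sqrt_le_1_alt.
  rewrite <- (pow2_abs a), <- (pow2_abs b); nra.
Qed.

Lemma Rabs_le_norm (a b : R) : Rabs a <= sqrt (a ^ 2 + b ^ 2).
Proof.
  rewrite <- (sqrt_pow2 (Rabs a)) by apply Rabs_pos; apply sqrt_le_1_alt.
  rewrite pow2_abs; pose proof (pow2_ge_0 b); lra.
Qed.

Lemma R2_fst_continuous : continuous (fun p : R2top => fst p : Rtop).
Proof.
  intros U oU p Up; destruct (oU _ Up) as (d & hd & h); exists d; split; auto.
  intros y hy; apply h; eapply Rle_lt_trans; [apply Rabs_le_norm|exact hy].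
Qed.

Lemma R2_snd_continuous : continuous (fun p : R2top => snd p : Rtop).
Proof.
  intros U oU p Up; destruct (oU _ Up) as (d & hd & h); exists d; split; auto.
  intros y hy; apply h; eapply Rle_lt_trans; [|exact hy].
  rewrite Rplus_comm; apply Rabs_le_norm.
Qed.

Lemma continuous_to_R2 {X : Space} (f : X -> R2top) : is_topology X ->
  continuous (fun x => fst (f x) : Rtop) -> continuous (fun x => snd (f x) : Rtop) ->
  continuous f.
Proof.
  intros tX c1 c2; apply continuous_local; auto; intros x U oU Ux.
  destruct (oU _ Ux) as (d & hd & h).
  exists (fun y => Rabs (fst (f y) - fst (f x)) < d / 2 /\ Rabs (snd (f y) - snd (f x)) < d / 2).
  repeat split.
  - apply (proj1 (proj2 tX));
      [apply (open_ball_R (fun y => fst (f y)))|apply (open_ball_R (fun y => snd (f y)))]; auto.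
  - rewrite Rminus_diag, Rabs_R0; lra.
  - rewrite Rminus_diag, Rabs_R0; lra.
  - intros y [h1 h2]; apply h; eapply Rle_lt_trans; [apply sqrt_norm_le|lra].
Qed.

(** In this form the equation is linear in [INR (S n)], so subtracting it for two circles leaves a
    multiple of the squared norm. *)
Lemma onC_iff (n : nat) (p : R * R) :
  onC n p <-> INR (S n) * (fst p ^ 2 + snd p ^ 2) = 2 * fst p.
Proof.
  unfold onC; assert (hc : 0 < INR (S n)) by (apply lt_0_INR; lia).
  set (c := INR (S n)) in *; destruct p as [u v]; cbn [fst snd].
  assert (E : (u - / c) ^ 2 + v ^ 2 - (/ c) ^ 2 = (c * (u ^ 2 + v ^ 2) - 2 * u) * / c)
    by (field; lra).
  pose proof (Rinv_0_lt_compat c hc); split; intro h.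
  - assert (E' : (c * (u ^ 2 + v ^ 2) - 2 * u) * / c = 0) by lra.
    apply Rmult_integral in E'; lra.
  - rewrite h, Rminus_diag, Rmult_0_l in E; lra.
Qed.

Lemma onC_0 (n : nat) : onC n (0, 0).
Proof. apply onC_iff; cbn [fst snd]; ring. Qed.

Lemma onC_inter (m n : nat) (p : R * R) : m <> n -> onC m p -> onC n p -> p = (0, 0).
Proof.
  rewrite !onC_iff; intros ne hm hn; destruct p as [u v]; cbn [fst snd] in *.
  assert (hne : INR (S m) <> INR (S n)) by (intro h; apply INR_eq in h; lia).
  assert (E : (INR (S m) - INR (S n)) * (u ^ 2 + v ^ 2) = 0) by lra.
  apply Rmult_integral in E as [E|E]; [lra|].
  rewrite E in hm; f_equal; [lra|nra].
Qed.

(* On the [m]-th circle [(k+1)|p|^2 - 2 p_1] equals [(k-m)|p|^2]. *)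
Lemma onC_open (k : nat) (q : HE) : onC k (proj1_sig q) -> proj1_sig q <> (0, 0) ->
  exists V, isOpen V /\ V q /\ forall q', V q' -> onC k (proj1_sig q').
Proof.
  intros hk hq; apply onC_iff in hk as hk'.
  set (N := fun p : HE => fst (proj1_sig p) * fst (proj1_sig p) + snd (proj1_sig p) * snd (proj1_sig p)).
  set (F := fun p : HE => INR (S k) * N p - 2 * fst (proj1_sig p)).
  assert (cu : continuous (fun p : HE => fst (proj1_sig p) : Rtop)).
  { apply (continuous_comp (fun p : R2top => fst p : Rtop)); [apply R2_fst_continuous|].
    apply continuous_proj1. }
  assert (cv : continuous (fun p : HE => snd (proj1_sig p) : Rtop)).
  { apply (continuous_comp (fun p : R2top => snd p : Rtop)); [apply R2_snd_continuous|].
    apply continuous_proj1. }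
  assert (cN : continuous (N : HE -> Rtop)) by (unfold N; cont).
  assert (cF : continuous (F : HE -> Rtop)) by (unfold F; cont).
  assert (Nq : 0 < N q).
  { unfold N; destruct (proj1_sig q) as [u v]; cbn [fst snd].
    destruct (Req_dec u 0) as [->|]; [destruct (Req_dec v 0) as [->|]|]; [congruence|nra|nra]. }
  assert (Fq : F q = 0) by (unfold F; rewrite <- hk'; unfold N; ring).
  (* On another circle the absolute value of [F p] is at least [N p], which the first bound keeps
     above [N q / 2]; the second bound excludes this. *)
  exists (fun p => Rabs (N p - N q) < N q / 2 /\ Rabs (F p - F q) < N q / 2); repeat split.
  - apply (proj1 (proj2 HE_topology)); apply open_ball_R; auto.
  - rewrite Rminus_diag, Rabs_R0; lra.
  - rewrite Rminus_diag, Rabs_R0; lra.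
  - intros p [h1 h2]; rewrite Fq, Rminus_0_r in h2.
    apply Rabs_def2 in h1, h2; destruct p as [p [m hm]]; cbn [proj1_sig] in *.
    destruct (Nat.eq_dec m k) as [->|ne]; auto; exfalso.
    assert (hm' := proj1 (onC_iff m p) hm); unfold F, N in h1, h2; cbn [proj1_sig] in h1, h2.
    set (N' := fst p * fst p + snd p * snd p) in *.
    replace (fst p ^ 2 + snd p ^ 2) with N' in hm' by (unfold N'; ring).
    rewrite <- hm' in h2.
    destruct (Nat.lt_total m k) as [hlt|[|hlt]]; [|lia|];
      apply le_INR in hlt; rewrite !S_INR in *; nra.
Qed.

Lemma circle_in_HE (n : nat) (p : S1) :
  onC n ((1 - fst (proj1_sig p)) / INR (S n), - snd (proj1_sig p) / INR (S n)).
Proof.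
  apply onC_iff; destruct p as [[u v] h]; cbn [fst snd proj1_sig] in *.
  assert (hc : INR (S n) > 0) by (apply lt_0_INR; lia); set (c := INR (S n)) in *.
  replace (c * (((1 - u) / c) ^ 2 + (- v / c) ^ 2))
    with ((1 - 2 * u + (u ^ 2 + v ^ 2)) / c) by (field; lra).
  rewrite h; field; lra.
Qed.

(* The inverse of [eta] on the [n]-th circle. *)
Definition circle (n : nat) (p : S1) : HE :=
  exist _ ((1 - fst (proj1_sig p)) / INR (S n), - snd (proj1_sig p) / INR (S n))
    (ex_intro _ n (circle_in_HE n p)).

Lemma S1_fst_continuous : continuous (fun p : S1 => fst (proj1_sig p) : Rtop).
Proof.
  apply (continuous_comp (fun p : R2top => fst p : Rtop)); [apply R2_fst_continuous|].
  apply continuous_proj1.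
Qed.

Lemma S1_snd_continuous : continuous (fun p : S1 => snd (proj1_sig p) : Rtop).
Proof.
  apply (continuous_comp (fun p : R2top => snd p : Rtop)); [apply R2_snd_continuous|].
  apply continuous_proj1.
Qed.

Lemma circle_continuous (n : nat) : continuous (circle n).
Proof.
  pose proof S1_fst_continuous; pose proof S1_snd_continuous.
  apply continuous_to_sub; auto with topo; apply continuous_to_R2; auto with topo;
    cbn [circle proj1_sig fst snd]; unfold Rdiv; cont.
  replace (fun p : S1 => - snd (proj1_sig p)) with (fun p : S1 => 0 - snd (proj1_sig p))
    by (apply functional_extensionality; intro; ring); cont.
Qed.

Lemma circle_base (n : nat) : circle n s1base = b0.
Proof.
  apply sig_eq; cbn [circle proj1_sig s1base b0 fst snd].
  assert (INR (S n) > 0) by (apply lt_0_INR; lia); f_equal; field; lra.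
Qed.

(** The circles themselves shrink, whatever the maps [a n] are. The domain is arbitrary so as to
    cover loops and homotopies alike. *)
Lemma circle_vanishing {X : Space} (a : nat -> X -> S1) :
  vanishing b0 (fun n x => circle n (a n x)).
Proof.
  intros U oU U0; destruct (oU _ U0) as (A & oA & A0 & hA).
  destruct (oA _ A0) as (d & hd & hdA).
  (* On the unit circle |1 - u| <= 2 and |v| <= 1, so the [n]-th circle lies within 3/(n+1) of the
     base point. *)
  destruct (archimed_cor1 (d / 3) ltac:(lra)) as (N & hN & N0).
  exists N; intros n hn x; apply hA, hdA; cbn [circle proj1_sig b0 fst snd].
  assert (hinv : / INR (S n) < d / 3).
  { eapply Rle_lt_trans; [|exact hN]; apply Rinv_le_contravar;
      [apply lt_0_INR; lia | apply le_INR; lia]. }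
  assert (hpos : 0 < / INR (S n)) by (apply Rinv_0_lt_compat, lt_0_INR; lia).
  destruct (a n x) as [[u v] h]; cbn [proj1_sig fst snd] in *.
  eapply Rle_lt_trans; [apply sqrt_norm_le|]; rewrite !Rminus_0_r; unfold Rdiv.
  rewrite !Rabs_mult, Rabs_Ropp, (Rabs_pos_eq (/ _)) by lra.
  assert (h1 : Rabs (1 - u) <= 2) by (apply Rabs_le; nra).
  assert (h2 : Rabs v <= 1) by (apply Rabs_le; nra).
  nra.
Qed.

Lemma eta_circle (n : nat) (p : S1) : eta (circle n p) n = p.
Proof.
  unfold eta; destruct excluded_middle_informative as [h|h].
  - apply sig_eq; cbn [circle proj1_sig fst snd]; destruct p as [[u v] hp]; cbn [proj1_sig fst snd].
    assert (INR (S n) > 0) by (apply lt_0_INR; lia); f_equal; field; lra.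
  - elim h; apply circle_in_HE.
Qed.

Lemma eta_off_circle (m n : nat) (q : HE) : m <> n -> onC m (proj1_sig q) -> eta q n = s1base.
Proof.
  intros ne hm; unfold eta; destruct excluded_middle_informative as [h|h]; auto.
  apply sig_eq; cbn [proj1_sig s1base]; rewrite (onC_inter m n _ ne hm h); cbn [fst snd].
  f_equal; ring.
Qed.

Lemma eta_b0 : eta b0 = x0.
Proof.
  apply functional_extensionality; intro n; apply (eta_off_circle (S n)); auto; apply onC_0.
Qed.

Lemma circle_eta (n : nat) (q : HE) : onC n (proj1_sig q) -> circle n (eta q n) = q.
Proof.
  intro hn; unfold eta; destruct excluded_middle_informative as [h|h]; [|tauto].
  apply sig_eq; cbn [circle proj1_sig fst snd]; destruct (proj1_sig q) as [u v]; cbn [fst snd].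
  assert (INR (S n) > 0) by (apply lt_0_INR; lia); f_equal; field; lra.
Qed.

(** Covers both coordinates of [eta]. At the base point the affine formula and the constant agree,
    so either branch is close to [a]; elsewhere [onC_open] provides a neighbourhood inside one
    circle. *)
Lemma continuous_on_circle (n : nat) (l : R2top -> Rtop) (c a : R) :
  continuous l -> l (0, 0) = 0 ->
  continuous (fun q : HE => (if excluded_middle_informative (onC n (proj1_sig q))
                            then a + c * l (proj1_sig q) else a) : Rtop).
Proof.
  intros cl l0.
  assert (cl' : continuous (fun q : HE => a + c * l (proj1_sig q) : Rtop)).
  { cont; apply (continuous_comp l); auto; apply continuous_proj1. }
  match goal with |- continuous ?F => set (g := F) end.
  assert (g_or : forall q, (onC n (proj1_sig q) /\ g q = a + c * l (proj1_sig q)) \/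
                           (~ onC n (proj1_sig q) /\ g q = a))
    by (intro q; unfold g; destruct excluded_middle_informative; auto).
  assert (g_off : forall q k, k <> n -> onC k (proj1_sig q) -> g q = a).
  { intros q k hkn hk; destruct (g_or q) as [[hn ->]|[_ ->]]; auto.
    rewrite (onC_inter k n _ hkn hk hn), l0, Rmult_0_r; apply Rplus_0_r. }
  apply continuous_to_R; auto with topo; intros q eps he.
  destruct (classic (proj1_sig q = (0, 0))) as [E|ne].
  - assert (Eq : g q = a) by (apply (g_off q (S n)); auto; exact (eq_ind_r (onC (S n)) (onC_0 (S n)) E)).
    exists (fun q' => Rabs (a + c * l (proj1_sig q') - (a + c * l (proj1_sig q))) < eps).
    split; [|split].
    + apply (open_ball_R (fun q' : HE => a + c * l (proj1_sig q'))); auto.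
    + rewrite Rminus_diag, Rabs_R0; auto.
    + intros q' h; rewrite Eq; rewrite E, l0 in h; destruct (g_or q') as [[_ ->]|[_ ->]].
      * replace (a + c * 0) with a in h by ring; auto.
      * rewrite Rminus_diag, Rabs_R0; auto.
  - destruct (proj2_sig q) as [k hk]; cbn beta in hk.
    destruct (onC_open k q hk ne) as (V & oV & Vq & hV).
    destruct (Nat.eq_dec k n) as [->|hkn].
    + exists (fun q' => V q' /\ Rabs (a + c * l (proj1_sig q') - (a + c * l (proj1_sig q))) < eps).
      split; [|split].
      * apply (proj1 (proj2 HE_topology)); auto.
        apply (open_ball_R (fun q' : HE => a + c * l (proj1_sig q'))); auto.
      * split; auto; rewrite Rminus_diag, Rabs_R0; auto.
      * intros q' [Vq' h]; destruct (g_or q) as [[_ ->]|[no _]]; [|tauto].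
        destruct (g_or q') as [[_ ->]|[no _]]; [auto|elim no; auto].
    + exists V; repeat split; auto; intros q' Vq'.
      rewrite !(g_off _ k), Rminus_diag, Rabs_R0; auto.
Qed.

Lemma eta_coord_continuous (n : nat) : continuous (fun q : HE => eta q n).
Proof.
  apply continuous_to_sub; auto with topo; apply continuous_to_R2; auto with topo.
  - replace (fun q : HE => fst (proj1_sig (eta q n)) : Rtop) with
      (fun q : HE => (if excluded_middle_informative (onC n (proj1_sig q))
                      then 1 + - INR (S n) * fst (proj1_sig q) else 1) : Rtop).
    + apply (continuous_on_circle n (fun p => fst p)); auto; apply R2_fst_continuous.
    + apply functional_extensionality; intro q; unfold eta.
      destruct excluded_middle_informative; cbn [proj1_sig fst]; auto;
        refine (_ : @eq R _ _); ring.
  - replace (fun q : HE => snd (proj1_sig (eta q n)) : Rtop) with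
      (fun q : HE => (if excluded_middle_informative (onC n (proj1_sig q))
                      then 0 + - INR (S n) * snd (proj1_sig q) else 0) : Rtop).
    + apply (continuous_on_circle n (fun p => snd p)); auto; apply R2_snd_continuous.
    + apply functional_extensionality; intro q; unfold eta.
      destruct excluded_middle_informative; cbn [proj1_sig snd]; auto;
        refine (_ : @eq R _ _); ring.
Qed.

Lemma coord_loop (a : I -> T) (n : nat) : is_loop a x0 -> is_loop (fun t => a t n : S1) s1base.
Proof.
  intros (ca & a0 & a1); split; [|rewrite a0, a1; auto].
  apply (continuous_comp (fun x : T => x n)); auto; apply continuous_coord; auto with topo.
Qed.

Lemma eta_loop (c : I -> HE) : is_loop c b0 -> is_loop (fun t => eta (c t)) x0.
Proof.
  intros (cc & c0 & c1); split; [|rewrite c0, c1; split; apply eta_b0].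
  apply continuous_to_ProdN; auto with topo; intro n.
  apply (continuous_comp (fun q : HE => eta q n)); auto; apply eta_coord_continuous.
Qed.

Lemma circle_null_sequence (a : nat -> I -> S1) : (forall n, is_loop (a n) s1base) ->
  null_sequence b0 (fun n t => circle n (a n t)).
Proof.
  intro la; split; [|apply (circle_vanishing a)].
  intro n; destruct (la n) as (ca & a0 & a1); split; [|rewrite a0, a1; split; apply circle_base].
  apply (continuous_comp (circle n)); auto; apply circle_continuous.
Qed.

(* Reparametrize all coordinates simultaneously so that at most one is off the base
   point at any time. *)
Lemma loop_lifts_to_HE (a : I -> T) : is_loop a x0 ->
  exists c, is_loop c b0 /\ path_homotopic (fun t => eta (c t)) a.
Proof.
  intro la; assert (lan := fun n => coord_loop a n la).
  assert (na := circle_null_sequence _ lan).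
  exists (winf b0 (fun n t => circle n (a t n))); split; [apply winf_loop; auto|].
  (* While circle [k] is traversed, every other coordinate clock is at an end, so the image in the
     torus has [n]-th coordinate [a] read on the clock [lam n]. *)
  assert (E : (fun t => eta (winf b0 (fun n t => circle n (a t n)) t)) = (fun t n => a (lam n t) n)).
  { apply functional_extensionality; intro t; apply functional_extensionality; intro n.
    unfold winf; destruct (lam_ends t) as [k hk].
    assert (ends : forall m, m <> k -> a (lam m t) m = s1base).
    { intros m hm; destruct (lan m) as (_ & h0 & h1); destruct (hk m hm) as [-> | ->]; auto. }
    rewrite (dsum_at b0 _ t k) by (intros m hm; rewrite ends; auto; apply circle_base).
    destruct (Nat.eq_dec n k) as [->|ne]; [apply eta_circle|].
    rewrite (ends n ne); apply (eta_off_circle k); auto; apply circle_in_HE. }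
  rewrite E; destruct la as (ca & a0 & a1).
  (* In each coordinate separately the clock [lam n] is straightened to the identity; the product
     topology makes the joint homotopy continuous. *)
  exists (fun p n => a (segment (lam n) (fun s => s) p) n); split; [|split; [|split; [|split]]].
  - apply continuous_to_ProdN; auto with topo; intro n.
    apply (continuous_comp (fun t : I => a t n)); [apply lan|].
    apply segment_continuous; [apply lam_continuous|apply continuous_id].
  - intro s; apply functional_extensionality; intro n; rewrite segment_0; auto.
  - intro s; apply functional_extensionality; intro n; rewrite segment_1; auto.
  - intro t; apply functional_extensionality; intro n; rewrite segment_fixed by apply lam_0; auto.
  - intro t; apply functional_extensionality; intro n; rewrite segment_fixed by apply lam_1; auto.
Qed.

(** * The extension over the torus *)

Definition torus_extension {M : Space} (e : M) (f : HE -> M) (a : I -> T) : I -> M :=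
  winf e (fun n t => f (circle n (a t n))).

Lemma torus_extension_null {M : Space} (e : M) (f : HE -> M) (a : I -> T) :
  continuous f -> f b0 = e -> is_loop a x0 ->
  null_sequence e (fun n t => f (circle n (a t n))).
Proof.
  intros cf f0 la.
  destruct (circle_null_sequence _ (fun n => coord_loop a n la)) as [lc vc]; split.
  - intro n; destruct (lc n) as (cc & c0 & c1); split; [|rewrite c0, c1; auto].
    apply (continuous_comp f); auto.
  - intros U oU Ue; rewrite <- f0 in Ue; exact (vc _ (cf U oU) Ue).
Qed.

Lemma torus_extension_homotopic {M : Space} (e : M) (f : HE -> M) (a b : I -> T) :
  continuous f -> f b0 = e -> is_loop a x0 -> path_homotopic a b ->
  path_homotopic (torus_extension e f a) (torus_extension e f b).
Proof.
  intros cf f0 la (H & cH & H0 & H1 & Hl & Hr).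
  apply (winf_homotopic e _ _ (fun n p => f (circle n (H p n)))).
  - intro n; apply (continuous_comp f); auto; apply (continuous_comp (circle n));
      [apply circle_continuous|].
    apply (continuous_comp (fun x : T => x n)); auto; apply continuous_coord; auto with topo.
  - intros U oU Ue; rewrite <- f0 in Ue.
    exact (circle_vanishing (fun n p => H p n) _ (cf U oU) Ue).
  - intros n s; rewrite H0; auto.
  - intros n s; rewrite H1; auto.
  - intros n t; rewrite Hl, (proj1 (proj2 la)), <- f0; f_equal; apply circle_base.
  - intros n t; rewrite Hr, (proj2 (proj2 la)), <- f0; f_equal; apply circle_base.
Qed.

(** Makes the extension multiplicative, although infinitely many factors must pass each other: each
    [concat] is a pointwise product of sped-up loops, to which [winf_op] applies. *)
Lemma winf_concat {M : Space} {op : M -> M -> M} {e : M} (a b : nat -> I -> M) :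
  pre_delta_monoid M op e -> null_sequence e a -> null_sequence e b ->
  path_homotopic (winf e (fun n => concat (a n) (b n))) (concat (winf e a) (winf e b)).
Proof.
  intros hM na nb.
  set (u := fun t : I => clampI (2 * proj1_sig t)).
  set (v := fun t : I => clampI (2 * proj1_sig t - 1)).
  assert (cu : continuous u) by (unfold u; cont).
  assert (cv : continuous v) by (unfold v; cont).
  assert (u0 : u i0 = i0) by (apply clampI_le0; rewrite i0_val; lra).
  assert (v0 : v i0 = i0) by (apply clampI_le0; rewrite i0_val; lra).
  assert (u1 : u i1 = i1) by (apply clampI_ge1; rewrite i1_val; lra).
  assert (v1 : v i1 = i1) by (apply clampI_ge1; rewrite i1_val; lra).
  assert (nau := null_sequence_reparam e a (fun _ => u) na (fun _ => cu) (fun _ => u0) (fun _ => u1)).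
  assert (nbv := null_sequence_reparam e b (fun _ => v) nb (fun _ => cv) (fun _ => v0) (fun _ => v1)).
  replace (winf e (fun n => concat (a n) (b n)))
    with (fun t => op (winf e (fun n s => a n (u s)) t) (winf e (fun n s => b n (v s)) t)).
  - eapply ph_trans; [|apply (ph_op_concat _ _ hM); apply winf_loop; auto].
    apply (ph_op _ _ _ _ hM).
    + apply (winf_reparam_id e a (fun _ => u)); auto.
    + apply (winf_reparam_id e b (fun _ => v)); auto.
  - apply functional_extensionality; intro t.
    rewrite <- (winf_op _ _ t hM (proj1 nau) (proj1 nbv)).
    apply dsum_ext; intro n; symmetry; apply (concat_op _ _ _ hM); [apply na|apply nb].
Qed.

(** At every time [c] lies on some circle, so [f] after [c] is the disjoint sum of its parts on the
    single circles. However these visits interleave, [dsum_homotopic_winf] sorts them. *)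
Lemma torus_extension_eta {M : Space} {op : M -> M -> M} {e : M} (f : HE -> M) (c : I -> HE) :
  pre_delta_monoid M op e -> continuous f -> f b0 = e -> is_loop c b0 ->
  path_homotopic (torus_extension e f (fun t => eta (c t))) (fun t => f (c t)).
Proof.
  intros hM cf f0 lc.
  assert (na := torus_extension_null e f _ cf f0 (eta_loop c lc)).
  assert (out : forall t k, onC k (proj1_sig (c t)) ->
     forall m, m <> k -> f (circle m (eta (c t) m)) = e).
  { intros t k hk m hm; rewrite (eta_off_circle k) by auto; rewrite circle_base; auto. }
  assert (d : disjoint_supp e (fun m (t : I) => f (circle m (eta (c t) m)))).
  { intro t; destruct (proj2_sig (c t)) as [k hk]; exists k; apply (out t k hk). }
  replace (fun t => f (c t)) with (dsum e (fun m (t : I) => f (circle m (eta (c t) m)))).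
  - apply (ph_sym_loop e); [| |apply (dsum_homotopic_winf _ hM); auto].
    + split; [|split].
      * apply dsum_continuous; auto with topo; [intro m; apply na|exact (proj2 na)].
      * apply dsum_const; intro m; apply na.
      * apply dsum_const; intro m; apply na.
    + apply winf_loop; auto.
  - apply functional_extensionality; intro t; destruct (proj2_sig (c t)) as [k hk].
    rewrite (dsum_at e _ t k (out t k hk)), circle_eta; auto.
Qed.

Theorem mainTheorem11 (M : Space) (op : M -> M -> M) (e : M) :
  is_topology M -> pre_delta_monoid M op e -> path_connected M ->
  transfinitely_pi1_commutative e /\
  (forall f : HE -> M, continuous f -> f b0 = e ->
     exists g : (I -> T) -> (I -> M),
       induces_pi1_hom x0 e g /\
       (forall c, is_loop c b0 ->
          path_homotopic (g (fun t => eta (c t))) (fun t => f (c t))) /\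
       (forall g' : (I -> T) -> (I -> M),
          induces_pi1_hom x0 e g' ->
          (forall c, is_loop c b0 ->
             path_homotopic (g' (fun t => eta (c t))) (fun t => f (c t))) ->
          forall a, is_loop a x0 -> path_homotopic (g' a) (g a))).
Proof.
  intros _ hM _; split; [exact (pre_delta_monoid_transfinitely_commutative hM)|].
  intros f cf f0; exists (torus_extension e f).
  assert (hom : induces_pi1_hom x0 e (torus_extension e f)).
  { split; [|split].
    - intros a la; apply winf_loop, torus_extension_null; auto.
    - intros a b la _; apply torus_extension_homotopic; auto.
    - intros a b la lb; unfold torus_extension.
      replace (fun n t => f (circle n (concat a b t n))) with
        (fun n => concat (fun t => f (circle n (a t n))) (fun t => f (circle n (b t n)))).
      + apply (winf_concat _ _ hM); apply torus_extension_null; auto.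
      + do 2 (apply functional_extensionality; intro); unfold concat; destruct Rle_dec; auto. }
  split; [exact hom|split].
  - intros c lc; apply (torus_extension_eta f c hM); auto.
  (* Both homomorphisms are evaluated on a lift of [a] to the earring, where each gives [f] after
     [c]. *)
  - intros g' (gl & gh & _) hg' a la.
    destruct (loop_lifts_to_HE a la) as (c & lc & hc).
    assert (lec := eta_loop c lc).
    assert (lfc : is_loop (fun t => f (c t)) e).
    { destruct lc as (cc & c0 & c1); split; [apply (continuous_comp f); auto|].
      rewrite c0, c1; auto. }
    apply ph_trans with (g' (fun t => eta (c t))).
    { apply (ph_sym_loop e); auto. }
    apply ph_trans with (fun t => f (c t)); auto.
    apply ph_trans with (torus_extension e f (fun t => eta (c t))).
    + apply (ph_sym_loop e); [apply hom; auto|auto|apply (torus_extension_eta f c hM); auto].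
    + apply hom; auto.
Qed.
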